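(* One has $\mathring\mu_4(2\mid 2)_1=3$.
   Context: $\mathbb{R}^n$ and $\Lambda^2(\mathbb{R}^n)$ carry their canonical Euclidean norms. **Rational subspaces.** A linear subspace $B$ of $\mathbb{R}^n$ is rational if it has a basis of vectors with rational coordinates; $\mathfrak{R}_n(e)$ is the set of rational subspaces of $\mathbb{R}^n$ of dimension $e$. **Height.** For $B\in\mathfrak{R}_n(e)$, the Plücker coordinates of $B$ are the $\binom{n}{e}$ minors of size $e\times e$ of an $n\times e$ matrix whose columns form a basis of $B$ (well defined up to a nonzero scalar); choosing a representative $\Xi$ with integer coordinates with gcd $1$, set $H(B)=\|\Xi\|$ (Euclidean norm). **Angles.** For nonzero $X,Y\in\mathbb{R}^n$ let $\psi(X,Y)=\|X\wedge Y\|/(\|X\|\,\|Y\|)$ (sine of the angle). For subspaces $A,B$ of dimensions $d,e\ge 1$ and $t=\min(d,e)$, define $\psi_1(A,B),\dots,\psi_t(A,B)$ recursively: $\psi_1(A,B)=\min\psi(X,Y)$ over $X\in A\setminus\{0\}$, $Y\in B\setminus\{0\}$, attained at unit vectors $X_1,Y_1$; given $(X_1,Y_1),\dots,(X_j,Y_j)$, $\psi_{j+1}(A,B)=\min\psi(X,Y)$ over nonzero $X\in A$ orthogonal to $X_1,\dots,X_j$ and nonzero $Y\in B$ orthogonal to $Y_1,\dots,Y_j$, attained at unit vectors $X_{j+1},Y_{j+1}$. (These numbers do not depend on the choices.) **Irrationality and exponents.** Let $d,e\in\{1,\dots,n-1\}$ with $d+e\le n$ and $1\le j\le\min(d,e)$.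 $\mathfrak{I}_n(d,e)_j$ is the set of $d$-dimensional subspaces $A$ of $\mathbb{R}^n$ with $\dim(A\cap B)<j$ for all $B\in\mathfrak{R}_n(e)$. For $A\in\mathfrak{I}_n(d,e)_j$, $\mu_n(A\mid e)_j\in(0,+\infty]$ is the supremum of the $\beta>0$ such that $\psi_j(A,B)\le H(B)^{-\beta}$ for infinitely many $B\in\mathfrak{R}_n(e)$. Finally $\mathring\mu_n(d\mid e)_j=\inf_{A\in\mathfrak{I}_n(d,e)_j}\mu_n(A\mid e)_j$. *)

(* Defs.v *)
From HB Require Import structures.
From mathcomp Require Import all_boot all_order all_algebra.
From mathcomp Require Import all_classical all_reals all_analysis.

Set Implicit Arguments.
Unset Strict Implicit.
Unset Printing Implicit Defensive.

Import Order.TTheory GRing.Theory Num.Theory.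
Local Open Scope classical_set_scope.
Local Open Scope ring_scope.

Section Defs.
Variables (R : realType) (n : nat).
Local Notation V := 'rV[R]_n.

Definition dotp (x y : V) : R := \sum_(i < n) x 0 i * y 0 i.

(* The library norm on row vectors is the sup norm. *)
Definition enorm (x : V) : R := Num.sqrt (dotp x x).

(* Norm of x /\ y, for the Euclidean structure on the exterior square in which
   the e_i /\ e_j with i < j are orthonormal. *)
Definition wedge_norm (x y : V) : R :=
  Num.sqrt (\sum_(i < n) \sum_(j < n | (i < j)%N)
              (x 0 i * y 0 j - x 0 j * y 0 i) ^+ 2).

Definition psi (x y : V) : R := wedge_norm x y / (enorm x * enorm y).

Definition rational_subspaces (e : nat) : set {vspace V} :=
  [set B | \dim B = e /\
    exists b : seq V, basis_of B b /\
      forall v, v \in b -> forall i, exists q : rat, v 0 i = ratr q].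

(* Plücker coordinates are indexed by the increasing maps 'I_e -> 'I_n, which
   enumerate the e-element sets of coordinates. *)
Definition increasing (e : nat) (f : {ffun 'I_e -> 'I_n}) : bool :=
  [forall i : 'I_e, forall j : 'I_e, (i < j)%N ==> (f i < f j)%N].

(* Basis vectors are the rows, rather than the columns, of the matrix; the
   minors are the same. *)
Definition pluecker (e : nat) (b : e.-tuple V) (f : {ffun 'I_e -> 'I_n}) : R :=
  \det (\matrix_(i < e, j < e) (tnth b i) 0 (f j)).

(* The values of Xi at non-increasing maps play no role. *)
Definition primitive_pluecker (e : nat) (B : {vspace V})
    (Xi : {ffun {ffun 'I_e -> 'I_n} -> int}) : Prop :=
  (exists b : e.-tuple V, basis_of B b /\
     exists2 c : R, c != 0 &
       forall f, increasing f -> (Xi f)%:~R = c * pluecker b f) /\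
  \big[gcdn/0%N]_(f | increasing f) `|Xi f|%N = 1%N.

(* Meaningful for B in rational_subspaces e; Xi is then unique up to sign on
   increasing maps. *)
Definition height (e : nat) (B : {vspace V}) : R :=
  let Xi := xget [ffun=> 0] [set Xi | @primitive_pluecker e B Xi] in
  Num.sqrt (\sum_(f | increasing f) ((Xi f)%:~R) ^+ 2).

(* The pairs over which the next angle is minimized, once the pairs in s have
   been chosen. *)
Definition admissible (A B : {vspace V}) (s : seq (V * V)) : set (V * V) :=
  [set p | [/\ p.1 \in A, p.1 != 0, p.2 \in B, p.2 != 0 &
     forall q, q \in s -> dotp p.1 q.1 = 0 /\ dotp p.2 q.2 = 0]].

Definition minimizing (A B : {vspace V}) (s : seq (V * V)) : set (V * V) :=
  [set p | [/\ admissible A B s p, enorm p.1 = 1, enorm p.2 = 1 &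
     forall q, admissible A B s q -> psi p.1 p.2 <= psi q.1 q.2]].

(* [:: (X_1, Y_1); ...; (X_k, Y_k)], for some choice of the minimizers. *)
Fixpoint principal_pairs (A B : {vspace V}) (k : nat) : seq (V * V) :=
  if k is k'.+1 then
    let s := principal_pairs A B k' in
    rcons s (xget (0, 0) (minimizing A B s))
  else [::].

(* For 1 <= j <= min (\dim A) (\dim B), where the infimum is a minimum by
   compactness of the unit spheres. *)
Definition psi_ (j : nat) (A B : {vspace V}) : R :=
  inf [set psi p.1 p.2 | p in admissible A B (principal_pairs A B j.-1)].

Definition irrational_subspaces (d e j : nat) : set {vspace V} :=
  [set A | \dim A = d /\
    forall B, rational_subspaces e B -> (\dim (A :&: B) < j)%N].

Definition mu (e j : nat) (A : {vspace V}) : \bar R :=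
  ereal_sup [set beta%:E | beta in [set beta : R | 0 < beta /\
    infinite_set [set B | rational_subspaces e B /\
                          psi_ j A B <= height e B `^ (- beta)]]].

Definition mu_ring (d e j : nat) : \bar R :=
  ereal_inf [set mu e j A | A in irrational_subspaces d e j].

End Defs.

Arguments mu_ring R n d e j : clear implicits.

(* Main.v *)
Require Import Defs.
From HB Require Import structures.
From mathcomp Require Import all_boot all_order all_algebra.
From mathcomp Require Import all_classical all_reals all_analysis.
From mathcomp Require Import ring lra zify.

(** Write [xi] and [eta] for Plücker coordinates of two planes [A] and [B] of
    R^4, and [xi /\ eta] for their pairing [klein] (the determinant of the four
    basis vectors).  The angle is controlled from below by

      psi_1 (A, B) >= |xi /\ eta| / (|xi| |eta|)            ([psi_1_ge])

    since the right-hand side is the product psi_1 psi_2, and from above by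
    |a - b| / |b| for any nonzero a in [A] and b in [B] ([psi_1_le]).

    Exponent at least 3 for every [A] ([mu_ge3]).  It is enough to use the
    rational planes [B] through the first basis vector [e0].  Such a plane is
    spanned by [e0] and (0, Y) with Y a primitive integer point of R^3, and its
    height is |Y| ([plane_height]).  Modulo [e0], the plane [A] becomes a plane
    of R^3 with some normal N, and [B] a line at distance |N.Y| / |N| from it,
    so that psi_1 (A, B) <= |N.Y| / (|N| |Y|) ([near_point]).  Dirichlet's
    pigeonhole principle makes |N.Y| as small as a constant times |Y|^-2, which
    gives psi_1 <= C H^-3 ([psi_1_small]); irrationality of [A] means that N.Y
    never vanishes, and forces the heights of these planes to be unbounded.

    Exponent at most 3 + O(epsilon) for some [A] ([mu_ring_le]).  By the first
    inequality it suffices that |xi /\ eta| >> H^(-2-epsilon) at all integer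
    points eta of the Klein quadric.  A generic xi fails, because there are too
    many eta.  The remedy is to let the six coordinates of xi span only a space
    of dimension three over Q: with x^2 + y^2 = 3 take

      xi = (x, 1, y, y, 3, x)   in the order 01, 02, 03, 12, 13, 23,

    which is on the Klein quadric.  Then xi /\ eta = a x + b y - c with integers
    a, b, c of size O(H), not all zero: otherwise eta would yield a rational
    point on the conic p^2 + q^2 = 3 r^2, and there is none
    ([circle_no_rational_point]).  A linear form in three integer variables can
    satisfy |a x + b y - c| >> H^(-2-epsilon), and a suitable point (x, y) of the
    circle exists by a measure argument ([circle_point]): the set of parameters
    for which |a x + b y - c| < delta has measure O(delta / sqrt D), where the
    integer D = 3 (a^2 + b^2) - c^2 is nonzero by the same anisotropy (the set is
    empty if D < 0), the sum of 1 / sqrt D over c is bounded, and the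
    values of delta are chosen to be summable over a and b. *)

Set Implicit Arguments.
Unset Strict Implicit.
Unset Printing Implicit Defensive.

Import Order.TTheory GRing.Theory Num.Theory.
Local Open Scope classical_set_scope.
Local Open Scope ring_scope.

(** * Increasing pairs of coordinates *)

Local Notation o0 := (@Ordinal 4 0 isT).
Local Notation o1 := (@Ordinal 4 1 isT).
Local Notation o2 := (@Ordinal 4 2 isT).
Local Notation o3 := (@Ordinal 4 3 isT).

Lemma ord4P (P : 'I_4 -> Prop) : P o0 -> P o1 -> P o2 -> P o3 -> forall i, P i.
Proof.
move=> P0 P1 P2 P3 [[|[|[|[|m]]]] Hm] //.
- by rewrite (_ : Ordinal Hm = o0) //; apply/val_inj.
- by rewrite (_ : Ordinal Hm = o1) //; apply/val_inj.
- by rewrite (_ : Ordinal Hm = o2) //; apply/val_inj.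
- by rewrite (_ : Ordinal Hm = o3) //; apply/val_inj.
Qed.

Lemma sum_ord4 (M : nmodType) (F : 'I_4 -> M) :
  \sum_(i < 4) F i = F o0 + F o1 + F o2 + F o3.
Proof.
rewrite !big_ord_recr big_ord0 /= add0r.
by congr (F _ + F _ + F _ + F _); apply/val_inj.
Qed.

Definition pair_map (i j : 'I_4) : {ffun 'I_2 -> 'I_4} :=
  [ffun k => if k == 0 then i else j].

Lemma pair_map_eta (f : {ffun 'I_2 -> 'I_4}) :
  f = pair_map (f ord0) (f (lift ord0 ord0)).
Proof.
apply/ffunP => k; rewrite ffunE.
by case: (unliftP ord0 k) => [k' ->|->] //; rewrite (ord1 k').
Qed.

Lemma increasing2E (f : {ffun 'I_2 -> 'I_4}) :
  increasing f = (f ord0 < f (lift ord0 ord0))%N.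
Proof.
apply/forallP/idP => [/(_ ord0)/forallP/(_ (lift ord0 ord0))/implyP->//|h].
move=> i; apply/forallP => j; apply/implyP.
case: (unliftP ord0 i) => [i' ->|->]; last first.
  by case: (unliftP ord0 j) => [j' ->|->] //; rewrite (ord1 j').
by rewrite (ord1 i'); case: (unliftP ord0 j) => [j' ->|->] //; rewrite (ord1 j').
Qed.

(** Turns every sum or gcd over [increasing] maps in the definitions into an
    explicit expression in the six Plücker coordinates. *)
Lemma big_increasing (T : Type) (idx : T) (op : Monoid.com_law idx)
    (G : {ffun 'I_2 -> 'I_4} -> T) :
  \big[op/idx]_(f | increasing f) G f =
  op (G (pair_map o0 o1)) (op (G (pair_map o0 o2)) (op (G (pair_map o0 o3))
  (op (G (pair_map o1 o2)) (op (G (pair_map o1 o3)) (G (pair_map o2 o3)))))).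
Proof.
rewrite (reindex (fun p : 'I_4 * 'I_4 => pair_map p.1 p.2)); last first.
  exists (fun f : {ffun 'I_2 -> 'I_4} => (f ord0, f (lift ord0 ord0))) => [[i j] _|f _].
    by rewrite /pair_map !ffunE.
  exact/esym/pair_map_eta.
rewrite (eq_bigl (fun p : 'I_4 * 'I_4 => (p.1 < p.2)%N)); last first.
  by move=> [i j]; rewrite increasing2E /pair_map !ffunE.
rewrite -(pair_big_dep xpredT (fun i j : 'I_4 => (i < j)%N)
  (fun i j => G (pair_map i j))) /=.
under eq_bigr do rewrite big_mkcond.
rewrite !big_ord_recl !big_ord0 /=.
rewrite ?Monoid.mulm1 ?Monoid.mul1m.
rewrite -!Monoid.mulmA.
by do ![congr (op _ _)]; congr (G (pair_map _ _)); apply/val_inj.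
Qed.


(** * Plücker coordinates of planes *)

Section PlueckerAlgebra.
Variable R : realType.
Local Notation V := 'rV[R]_4.
Implicit Types (x y z v : V) (B : {vspace V}) (p q G : 'I_4 -> 'I_4 -> R).

(** The coordinates of x /\ y; only the six entries with i < j carry information. *)
Definition wedge x y (i j : 'I_4) : R := x 0 i * y 0 j - x 0 j * y 0 i.

Definition sum6 G : R := G o0 o1 + G o0 o2 + G o0 o3 + G o1 o2 + G o1 o3 + G o2 o3.

Definition sqnorm6 p : R := sum6 (fun i j => p i j ^+ 2).

(** The polar form of the Klein quadric: [klein (wedge x x') (wedge y y')] is the
    determinant of x, x', y, y'. *)
Definition klein p q : R :=
  p o0 o1 * q o2 o3 - p o0 o2 * q o1 o3 + p o0 o3 * q o1 o2
  + p o1 o2 * q o0 o3 - p o1 o3 * q o0 o2 + p o2 o3 * q o0 o1.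

Lemma dotpE x y :
  dotp x y = x 0 o0 * y 0 o0 + x 0 o1 * y 0 o1 + x 0 o2 * y 0 o2 + x 0 o3 * y 0 o3.
Proof. exact: sum_ord4. Qed.

Lemma dotp_ge0 x : 0 <= dotp x x.
Proof. by apply: sumr_ge0 => i _; rewrite -expr2 sqr_ge0. Qed.

Lemma dotp_gt0 x : x != 0 -> 0 < dotp x x.
Proof.
move=> x0; rewrite lt_neqAle dotp_ge0 andbT eq_sym; apply: contra x0.
rewrite /dotp psumr_eq0 => [/allP h|i _]; last by rewrite -expr2 sqr_ge0.
apply/eqP/rowP => i; rewrite mxE.
by have := h i (mem_index_enum _); rewrite /= -expr2 sqrf_eq0 => /eqP.
Qed.

Lemma wedge_normE x y : wedge_norm x y = Num.sqrt (sqnorm6 (wedge x y)).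
Proof.
rewrite /wedge_norm; congr Num.sqrt.
under eq_bigr do rewrite big_mkcond.
by rewrite sum_ord4 !sum_ord4 /= !addr0 !add0r /sqnorm6 /sum6 !addrA.
Qed.

Lemma sqnorm6_ge0 p : 0 <= sqnorm6 p.
Proof. by rewrite /sqnorm6 /sum6 !addr_ge0// sqr_ge0. Qed.

Lemma lagrange x y : sqnorm6 (wedge x y) = dotp x x * dotp y y - dotp x y ^+ 2.
Proof. by rewrite /sqnorm6 /sum6 /wedge !dotpE; ring. Qed.

(** Both sides are a determinant of the same four vectors, up to one transposition. *)
Lemma klein_exchange x x' y y' :
  klein (wedge x x') (wedge y y') = - klein (wedge x y) (wedge x' y').
Proof. by rewrite /klein /wedge; ring. Qed.

Lemma klein_wedge x y : klein (wedge x y) (wedge x y) = 0.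
Proof. by rewrite /klein /wedge; ring. Qed.

(** The difference of the two sides is a sum of squares of 2 x 2 minors, by
    Lagrange's identity in dimension six, after the sign changes of [klein]. *)
Lemma klein_cauchy_schwarz p q : klein p q ^+ 2 <= sqnorm6 p * sqnorm6 q.
Proof.
rewrite /klein /sqnorm6 /sum6.
set a1 := p o0 o1; set a2 := p o0 o2; set a3 := p o0 o3.
set a4 := p o1 o2; set a5 := p o1 o3; set a6 := p o2 o3.
set b6 := q o0 o1; set b5 := q o0 o2; set b4 := q o0 o3.
set b3 := q o1 o2; set b2 := q o1 o3; set b1 := q o2 o3.
rewrite -subr_ge0.
have -> : (a1 ^+ 2 + a2 ^+ 2 + a3 ^+ 2 + a4 ^+ 2 + a5 ^+ 2 + a6 ^+ 2) *
   (b6 ^+ 2 + b5 ^+ 2 + b4 ^+ 2 + b3 ^+ 2 + b2 ^+ 2 + b1 ^+ 2) -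
   (a1 * b1 - a2 * b2 + a3 * b3 + a4 * b4 - a5 * b5 + a6 * b6) ^+ 2
   = (a1 * b2 + a2 * b1) ^+ 2 + (a1 * b3 - a3 * b1) ^+ 2 + (a1 * b4 - a4 * b1) ^+ 2
   + (a1 * b5 + a5 * b1) ^+ 2 + (a1 * b6 - a6 * b1) ^+ 2
   + (a2 * b3 + a3 * b2) ^+ 2 + (a2 * b4 + a4 * b2) ^+ 2 + (a2 * b5 - a5 * b2) ^+ 2
   + (a2 * b6 + a6 * b2) ^+ 2 + (a3 * b4 - a4 * b3) ^+ 2 + (a3 * b5 + a5 * b3) ^+ 2
   + (a3 * b6 - a6 * b3) ^+ 2 + (a4 * b5 + a5 * b4) ^+ 2 + (a4 * b6 - a6 * b4) ^+ 2
   + (a5 * b6 + a6 * b5) ^+ 2 by ring.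
by rewrite !addr_ge0 ?sqr_ge0.
Qed.

Lemma basis2_memP B x y v : basis_of B [:: x; y] ->
  reflect (exists a b, v = a *: x + b *: y) (v \in B).
Proof.
move=> /span_basis <-; rewrite span_cons span_seq1.
apply: (iffP memv_addP) => [[u /vlineP[a ->] [w /vlineP[b ->] ->]]|[a [b ->]]].
  by exists a, b.
by exists (a *: x); rewrite ?memvZ ?memv_line//; exists (b *: y); rewrite ?memvZ ?memv_line.
Qed.

Lemma free2P x y : reflect (exists i j, wedge x y i j != 0) (free [:: x; y]).
Proof.
apply: (iffP idP) => [|[i [j pij]]].
  rewrite free_cons seq1_free span_seq1 => /andP[xNy y0].
  have [k yk] : exists k, y 0 k != 0.
    apply/existsP; move: y0; apply: contraR; rewrite negb_exists => /forallP y0.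
    by apply/eqP/rowP => k; rewrite mxE; apply/eqP/negPn.
  suff /existsP[i /existsP h] : [exists i, exists j, wedge x y i j != 0] by exists i.
  move: xNy; apply: contraR; rewrite negb_exists => /forallP p0.
  apply/vlineP; exists (x 0 k / y 0 k); apply/rowP => i; rewrite mxE.
  move: (p0 i); rewrite negb_exists => /forallP/(_ k); rewrite negbK /wedge.
  by rewrite subr_eq0 => /eqP e; rewrite mulrAC -e mulfK.
rewrite free_cons seq1_free span_seq1; apply/andP; split.
  apply: contra pij => /vlineP[c ->]; rewrite /wedge !mxE; apply/eqP; ring.
apply: contra pij => /eqP ->; rewrite /wedge !mxE; apply/eqP; ring.
Qed.

Lemma plueckerE (b : 2.-tuple V) i j :
  pluecker b (pair_map i j) = wedge (tnth b ord0) (tnth b (lift ord0 ord0)) i j.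
Proof.
rewrite /pluecker (expand_det_row _ ord0) !big_ord_recl big_ord0 /cofactor.
rewrite !det_mx11 !mxE /pair_map !ffunE /= /wedge.
by rewrite expr0 /= /bump /= expr1; ring.
Qed.

Lemma basis2_wedge B x y x' y' : basis_of B [:: x; y] -> basis_of B [:: x'; y'] ->
  exists2 c, c != 0 & forall i j, wedge x' y' i j = c * wedge x y i j.
Proof.
move=> bx bx'.
have /(basis2_memP _ bx)[a [b ex]] : x' \in B.
  by apply: (basis_mem bx'); rewrite inE eqxx.
have /(basis2_memP _ bx)[c [d ey]] : y' \in B.
  by apply: (basis_mem bx'); rewrite !inE eqxx orbT.
have e i j : wedge x' y' i j = (a * d - b * c) * wedge x y i j.
  by rewrite /wedge ex ey !mxE; ring.
exists (a * d - b * c) => //.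
have /free2P[i [j]] := basis_free bx'.
by rewrite e mulf_eq0 negb_or => /andP[].
Qed.

(** A plane is recovered from its Plücker coordinates: v belongs to it as soon as
    the 3 x 3 minors of v with a basis vanish, and these minors are linear in
    the Plücker coordinates. *)
Lemma wedge_basis2 B B' x y x' y' c : basis_of B [:: x; y] ->
  basis_of B' [:: x'; y'] -> (forall i j, wedge x' y' i j = c * wedge x y i j) ->
  (B' <= B)%VS.
Proof.
move=> bx bx' e.
have /free2P[i [j pij]] := basis_free bx'.
have pij' : wedge x y i j != 0 by move: pij; rewrite e mulf_eq0 negb_or => /andP[].
have c0 : c != 0 by move: pij; rewrite e mulf_eq0 negb_or => /andP[].
have main v : (forall k, v 0 i * wedge x' y' j k - v 0 j * wedge x' y' i k
     + v 0 k * wedge x' y' i j = 0) -> v \in B.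
  move=> h; apply/(basis2_memP _ bx).
  exists (wedge v y i j / wedge x y i j), (wedge x v i j / wedge x y i j).
  apply/rowP => k; rewrite !mxE.
  have {h} : v 0 k * wedge x y i j = v 0 j * wedge x y i k - v 0 i * wedge x y j k.
    by have := h k; rewrite !e => h'; apply: (mulfI c0); lra.
  move=> h; apply: (mulIf pij'); rewrite h.
  by rewrite mulrDl (mulrAC (_ / _) (x 0 k)) (mulrAC (_ / _) (y 0 k)) !mulfVK // /wedge; ring.
apply/subvP => v /(basis2_memP _ bx')[a [b ->]].
by apply: main => k; rewrite /wedge !mxE; ring.
Qed.

End PlueckerAlgebra.

(** * Primitive Plücker coordinates and heights *)

Section Heights.
Variable R : realType.
Local Notation V := 'rV[R]_4.
Implicit Types (x y z v : V) (B : {vspace V}).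
Implicit Types (Xi : {ffun {ffun 'I_2 -> 'I_4} -> int}).

Lemma biggcdn_mulr (I : finType) (P : pred I) (F : I -> nat) (k : nat) :
  ((\big[gcdn/0]_(i | P i) F i) * k = \big[gcdn/0]_(i | P i) (F i * k))%N.
Proof.
by apply: (big_morph (fun n => n * k)%N) => [a b|]; rewrite ?mul0n ?muln_gcdl.
Qed.

Lemma tuple2E (T : Type) (b : 2.-tuple T) :
  b = [:: tnth b ord0; tnth b (lift ord0 ord0)] :> seq T.
Proof. by case: b => [[|s [|t [|]]]]. Qed.

(** Scaling one basis vector absorbs the proportionality factor, so that integer
    Plücker coordinates are exactly the minors of some basis. *)
Lemma primitive_pluecker_wedge B Xi : primitive_pluecker B Xi ->
  exists x y, basis_of B [:: x; y] /\
    forall f, increasing f -> (Xi f)%:~R = wedge x y (f ord0) (f (lift ord0 ord0)).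
Proof.
move=> [[b [bB [c c0 h]]] _].
move: bB; rewrite tuple2E; set x := tnth _ _; set y := tnth _ _ => bB.
exists (c *: x), y; split.
  rewrite /basis_of; apply/andP; split; last first.
    have /free2P[i [j p]] := basis_free bB.
    apply/free2P; exists i, j; rewrite /wedge !mxE.
    rewrite (_ : _ - _ = c * wedge x y i j) ?mulf_neq0 //.
    by rewrite /wedge; ring.
  rewrite -(span_basis bB) !span_cons; apply/eqP; congr (_ + _)%VS.
  apply/eqP; rewrite eqEsubv -!memvE memvZ ?memv_line //.
  by apply/vlineP; exists c^-1; rewrite scalerA mulVf // scale1r.
move=> f incf; rewrite h // [f in pluecker b f]pair_map_eta.
by rewrite plueckerE /wedge !mxE -/x -/y; ring.
Qed.

(** Two primitive vectors are proportional, Xi' g * Xi g' = Xi g * Xi' g'; taking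
    the gcd over one index makes the factor a sign. *)
Lemma primitive_pluecker_abs B Xi Xi' f :
  primitive_pluecker B Xi -> primitive_pluecker B Xi' -> increasing f ->
  `|Xi f|%N = `|Xi' f|%N.
Proof.
move=> prim prim'.
have [x [y [bxy h]]] := primitive_pluecker_wedge prim.
have [x' [y' [bxy' h']]] := primitive_pluecker_wedge prim'.
have [c c0 e] := basis2_wedge bxy bxy'.
have prop g : increasing g -> (Xi' g)%:~R = c * (Xi g)%:~R :> R.
  by move=> ig; rewrite h // h' // e.
have cross g g' : increasing g -> increasing g' ->
    (`|Xi' g| * `|Xi g'| = `|Xi g| * `|Xi' g'|)%N.
  move=> ig ig'; rewrite -!abszM; congr absz; apply: (@intr_inj R).
  by rewrite !intrM !prop //; ring.
have same g : increasing g -> `|Xi g|%N = `|Xi' g|%N.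
  move=> ig.
  have : ((\big[gcdn/0]_(g' | increasing g') `|Xi' g'|) * `|Xi g| =
          (\big[gcdn/0]_(g' | increasing g') `|Xi g'|) * `|Xi' g|)%N.
    by rewrite !biggcdn_mulr; apply: eq_bigr => g' ig'; rewrite cross.
  by rewrite (proj2 prim) (proj2 prim') !mul1n.
exact: same.
Qed.

(** By uniqueness up to sign, the height may be computed from any primitive
    representative. *)
Lemma height_wedge B Xi x y : primitive_pluecker B Xi ->
  (forall f, increasing f -> (Xi f)%:~R = wedge x y (f ord0) (f (lift ord0 ord0))) ->
  height 2 B = Num.sqrt (sqnorm6 (wedge x y)).
Proof.
move=> prim h; rewrite /height; set Xi' := xget _ _.
have prim' : primitive_pluecker B Xi' by apply: (xgetPex [ffun=> 0]); exists Xi.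
have abs2 f : increasing f -> (Xi' f)%:~R ^+ 2 = (Xi f)%:~R ^+ 2 :> R.
  move=> incf; rewrite -[LHS]real_normK ?num_real // -[RHS]real_normK ?num_real //.
  by rewrite -!intr_norm -!abszE (primitive_pluecker_abs prim prim' incf).
congr Num.sqrt; rewrite (eq_bigr _ abs2) (eq_bigr _ (fun f incf => congr1 (fun r => r ^+ 2) (h f incf))).
by rewrite big_increasing !ffunE /sqnorm6 /sum6 /= !addrA.
Qed.

Lemma height_ge1 B Xi : primitive_pluecker B Xi -> 1 <= height 2 B.
Proof.
move=> prim; have [x [y [_ h]]] := primitive_pluecker_wedge prim.
rewrite (height_wedge prim h) -sqrtr1 ler_wsqrtr //.
have : sqnorm6 (wedge x y) = (\sum_(f | @increasing 4 2 f) Xi f ^+ 2)%:~R.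
  rewrite big_increasing /sqnorm6 /sum6 /= !rmorphD /= !rmorphXn /= !h ?increasing2E ?ffunE //=.
  by rewrite !addrA.
move=> ->; rewrite -[1]/(1%:~R) ler_int.
have [f incf f0] : exists2 f, increasing f & Xi f != 0.
  have := proj2 prim; case: (pselect (exists2 f, increasing f & Xi f != 0)) => // nex.
  rewrite big1 // => f incf; apply/eqP; rewrite absz_eq0; apply/negPn/negP => f0.
  by apply: nex; exists f.
rewrite (bigD1 f) //= -[1]addr0 lerD //; last by apply: sumr_ge0 => g _; exact: sqr_ge0.
by rewrite -gtz0_ge1 lt_neqAle sqr_ge0 andbT eq_sym sqrf_eq0.
Qed.

Lemma pluecker_le_height B Xi f : primitive_pluecker B Xi -> increasing f ->
  `|(Xi f)%:~R| <= height 2 B :> R.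
Proof.
move=> prim incf; have [x [y [_ h]]] := primitive_pluecker_wedge prim.
rewrite (height_wedge prim h) -sqrtr_sqr ler_wsqrtr //.
have -> : sqnorm6 (wedge x y) = \sum_(f | @increasing 4 2 f) (Xi f)%:~R ^+ 2.
  by rewrite (eq_bigr _ (fun f incf => congr1 (fun r => r ^+ 2) (h f incf)))
    big_increasing !ffunE /sqnorm6 /sum6 /= !addrA.
by rewrite (bigD1 f) //= lerDl; apply: sumr_ge0 => ? _; exact: sqr_ge0.
Qed.

Lemma common_denominator (I : finType) (w : I -> rat) :
  exists2 d : int, d != 0 & forall i, exists z : int, d%:~R * w i = z%:~R.
Proof.
exists (\prod_i denq (w i)); first by apply/prodf_neq0 => i _; exact: denq_neq0.
move=> i; exists (numq (w i) * \prod_(j | j != i) denq (w j)).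
rewrite (bigD1 i) //= !rmorphM /= -{2}(divq_num_den (w i)).
by field; rewrite intr_eq0 denq_neq0.
Qed.

(** Clear the denominators in the minors of a rational basis, then divide by the
    gcd. *)
Lemma primitive_pluecker_exists B : rational_subspaces 2 B ->
  exists Xi, primitive_pluecker B Xi.
Proof.
move=> [dB [b [bB ratb]]].
have szb : size b = 2%N by apply/(etrans _ dB)/esym/(@size_basis _ _ _ _ (in_tuple b)).
case: b szb bB ratb => [|x [|y []]] // _ bB ratb.
have [qx ex] := choice (ratb x (mem_head _ _)).
have yb : y \in [:: x; y] by rewrite !inE eqxx orbT.
have [qy ey] := choice (ratb y yb).
pose w (f : {ffun 'I_2 -> 'I_4}) := let i := f ord0 in let j := f (lift ord0 ord0) in
  qx i * qy j - qx j * qy i.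
have ew (f : {ffun 'I_2 -> 'I_4}) : wedge x y (f ord0) (f (lift ord0 ord0)) = ratr (w f).
  by rewrite /wedge !ex !ey /w rmorphB /= !rmorphM.
have [d d0 /choice[Z eZ]] := common_denominator w.
have eZR (f : {ffun 'I_2 -> 'I_4}) : (Z f)%:~R = d%:~R * wedge x y (f ord0) (f (lift ord0 ord0)) :> R.
  by rewrite ew -[LHS]ratr_int -eZ rmorphM /= ratr_int.
pose g := \big[gcdn/0%N]_(f | @increasing 4 2 f) `|Z f|%N.
have gZ f : increasing f -> (g %| `|Z f|)%N by move=> incf; exact: (biggcdn_inf f).
have g0 : (0 < g)%N.
  have [f incf Zf] : exists2 f, increasing f & Z f != 0.
    have /free2P[i [j pij]] := basis_free bB.
    wlog ltij : i j pij / (i < j)%N.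
      move=> H; case: (ltngtP i j) => [ltij|ltji|eij].
      - exact: (H i j).
      - apply: (H j i) => //; rewrite (_ : wedge x y j i = - wedge x y i j) ?oppr_eq0 //.
        by rewrite /wedge; ring.
      - by move: pij; rewrite /wedge (val_inj eij) subrr eqxx.
    exists (pair_map i j); first by rewrite increasing2E !ffunE.
    by rewrite -(intr_eq0 R) eZR !ffunE /= mulf_neq0 // intr_eq0.
  by apply: dvdn_gt0 (gZ f incf); rewrite lt0n absz_eq0.
have eg f : increasing f -> (`|(Z f %/ g)%Z| * g = `|Z f|)%N.
  by move=> incf; rewrite -[X in (_ * X)%N]/(`|g%:Z|%N) -abszM divzK //; exact: gZ.
exists [ffun f => (Z f %/ g)%Z]; split; last first.
  apply/eqP; rewrite -(eqn_pmul2r g0) mul1n biggcdn_mulr; apply/eqP.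
  by apply: eq_bigr => f incf; rewrite ffunE eg.
exists (in_tuple [:: x; y]); split => //.
exists (d%:~R / g%:~R); first by rewrite mulf_neq0 ?invr_eq0 ?intr_eq0 -?lt0n.
move=> f incf; rewrite ffunE.
move: (f ord0) (f (lift ord0 ord0)) (pair_map_eta f) incf => i j -> incf.
rewrite plueckerE !(tnth_nth 0) /=.
have gR : g%:~R != 0 :> R by rewrite intr_eq0 -lt0n.
apply: (mulIf gR); rewrite -intrM divzK; last exact: gZ.
by rewrite eZR !ffunE /= mulrAC mulfVK.
Qed.

(** Northcott property: a rational plane is determined by six integers that are
    bounded by its height. *)
Lemma finite_bounded_height (K : nat) :
  finite_set [set B : {vspace V} | rational_subspaces 2 B /\ height 2 B <= K%:R].
Proof.
pose F (g : {ffun {ffun 'I_2 -> 'I_4} -> 'I_(2 * K).+1}) : {vspace V} :=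
  xget 0%VS [set B | exists2 Xi, primitive_pluecker B Xi &
    forall f, increasing f -> Xi f = (g f)%:Z - K%:Z].
apply: (@sub_finite_set _ _ (F @` [set: _])); last first.
  by apply: finite_image; exact: finite_finset.
move=> B [ratB hB]; have [Xi prim] := primitive_pluecker_exists ratB.
have [x [y [bxy h]]] := primitive_pluecker_wedge prim.
have bound f : increasing f -> (`|Xi f| <= K)%N.
  move=> incf; rewrite -(ler_nat R) natr_absz intr_norm.
  exact: le_trans (pluecker_le_height prim incf) hB.
exists [ffun f => inord (absz (Xi f + K%:Z))] => //.
rewrite /F; case: xgetP => [B' _|] /=; last first.
  move=> /(_ B); case; exists Xi => // f incf.
  rewrite ffunE inordK; move: (bound f incf); lia.
move=> [Xi' prim' e'].
have eXi f : increasing f -> Xi' f = Xi f.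
  move=> incf; rewrite e' // ffunE inordK; move: (bound f incf); lia.
have [x' [y' [bxy' h']]] := primitive_pluecker_wedge prim'.
have e i j : wedge x' y' i j = 1 * wedge x y i j.
  rewrite mul1r.
  wlog ltij : i j / (i < j)%N.
    move=> H; case: (ltngtP i j) => [|ltji|eij]; first exact: H.
      have -> : wedge x' y' i j = - wedge x' y' j i by rewrite /wedge; ring.
      by rewrite H // /wedge; ring.
    by rewrite /wedge (val_inj eij) !subrr.
  have inc : increasing (pair_map i j) by rewrite increasing2E !ffunE.
  by have := h _ inc; rewrite -eXi // h' // !ffunE /=.
apply/eqP; rewrite eqEsubv (wedge_basis2 bxy bxy' e) /=.
by apply: (@wedge_basis2 _ _ _ _ _ _ _ 1 bxy' bxy) => i j; rewrite e !mul1r.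
Qed.

End Heights.

(** * Estimates of the first angle *)

Section FirstAngle.
Variable R : realType.
Local Notation V := 'rV[R]_4.
Implicit Types (x y z v : V) (A B : {vspace V}).

(** One Gram-Schmidt step without normalization: for z in the plane of x and y, a
    vector of that plane orthogonal to z, of length proportional to that of z. *)
Definition gs_partner x y z : V := dotp z y *: x - dotp z x *: y.

Lemma gs_partner_ortho a b x y (z := a *: x + b *: y) : dotp z (gs_partner x y z) = 0.
Proof. by rewrite /gs_partner !dotpE /z !mxE; ring. Qed.

Lemma wedge_gs_partner a b x y (z := a *: x + b *: y) i j :
  wedge z (gs_partner x y z) i j = - dotp z z * wedge x y i j.
Proof. by rewrite /gs_partner /wedge !dotpE /z !mxE; ring. Qed.

Lemma gs_partner_norm a b x y (z := a *: x + b *: y) :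
  dotp z z * dotp (gs_partner x y z) (gs_partner x y z) =
  dotp z z ^+ 2 * sqnorm6 (wedge x y).
Proof.
have := lagrange z (gs_partner x y z).
rewrite gs_partner_ortho expr0n subr0 => <-.
by rewrite /sqnorm6 /sum6 !wedge_gs_partner; ring.
Qed.

(** Complete X to an orthogonal basis (X, X') of A and Y to an orthogonal basis
    (Y, Y') of B.  The determinant of X, X', Y, Y' is at most
    |X /\ Y| |X' /\ Y'|, hence at most |X /\ Y| |X'| |Y'|; the squared form below
    avoids every division. *)
Lemma klein_le_wedge A B x x' y y' X Y :
  basis_of A [:: x; x'] -> basis_of B [:: y; y'] -> X \in A -> Y \in B ->
  klein (wedge x x') (wedge y y') ^+ 2 * (dotp X X * dotp Y Y) ^+ 2 <=
  (sqnorm6 (wedge x x') * sqnorm6 (wedge y y')) *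
     (sqnorm6 (wedge X Y) * (dotp X X * dotp Y Y)).
Proof.
move=> bA bB /(basis2_memP _ bA)[a [b eX]] /(basis2_memP _ bB)[c [d eY]].
set X' := gs_partner x x' X; set Y' := gs_partner y y' Y.
have kl : klein (wedge X X') (wedge Y Y') =
    dotp X X * dotp Y Y * klein (wedge x x') (wedge y y').
  have e1 i j : wedge X X' i j = - dotp X X * wedge x x' i j.
    by rewrite /X' eX wedge_gs_partner.
  have e2 i j : wedge Y Y' i j = - dotp Y Y * wedge y y' i j.
    by rewrite /Y' eY wedge_gs_partner.
  by rewrite /klein !e1 !e2; ring.
have n1 : dotp X X * dotp X' X' = dotp X X ^+ 2 * sqnorm6 (wedge x x').
  by rewrite /X' eX gs_partner_norm.
have n2 : dotp Y Y * dotp Y' Y' = dotp Y Y ^+ 2 * sqnorm6 (wedge y y').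
  by rewrite /Y' eY gs_partner_norm.
have le2 : sqnorm6 (wedge X' Y') <= dotp X' X' * dotp Y' Y'.
  by rewrite lagrange lerBlDr lerDl sqr_ge0.
have := klein_cauchy_schwarz (wedge X Y) (wedge X' Y').
have -> : klein (wedge X Y) (wedge X' Y') ^+ 2 = klein (wedge X X') (wedge Y Y') ^+ 2.
  by rewrite klein_exchange sqrrN.
rewrite kl => cs.
have [X0|X0] := eqVneq X 0.
  have -> : dotp X X = 0 by rewrite dotpE X0 !mxE; ring.
  by rewrite !mul0r expr0n !mulr0.
have [Y0|Y0] := eqVneq Y 0.
  have -> : dotp Y Y = 0 by rewrite dotpE Y0 !mxE; ring.
  by rewrite !mulr0 expr0n !mulr0.
have XX := dotp_gt0 X0; have YY := dotp_gt0 Y0.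
have XY : 0 < dotp X X * dotp Y Y by rewrite mulr_gt0.
rewrite -(ler_pM2l XY).
have {}cs := le_trans cs (ler_wpM2l (sqnorm6_ge0 _) le2).
have {}cs := ler_wpM2l (ltW XY) cs.
apply: le_trans (le_trans cs _); first by rewrite le_eqVlt; apply/orP; left; apply/eqP; ring.
have -> : dotp X X * dotp Y Y * (sqnorm6 (wedge X Y) * (dotp X' X' * dotp Y' Y'))
  = sqnorm6 (wedge X Y) * (dotp X X * dotp X' X') * (dotp Y Y * dotp Y' Y') by ring.
by rewrite n1 n2 le_eqVlt; apply/orP; left; apply/eqP; ring.
Qed.

Lemma psi_ge0 x y : 0 <= psi x y.
Proof. by rewrite /psi divr_ge0 ?mulr_ge0 ?sqrtr_ge0. Qed.

Lemma psi_ge_klein A B x x' y y' X Y :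
  basis_of A [:: x; x'] -> basis_of B [:: y; y'] ->
  X \in A -> Y \in B -> X != 0 -> Y != 0 ->
  `|klein (wedge x x') (wedge y y')| <=
     Num.sqrt (sqnorm6 (wedge x x')) * Num.sqrt (sqnorm6 (wedge y y')) * psi X Y.
Proof.
move=> bA bB XA YB X0 Y0.
have := klein_le_wedge bA bB XA YB.
have XX := dotp_gt0 X0; have YY := dotp_gt0 Y0.
have XY : 0 < dotp X X * dotp Y Y by rewrite mulr_gt0.
move: XY; set M := dotp X X * dotp Y Y => XY.
rewrite (exprS M 1) expr1 (mulrA _ M M) (mulrA (_ * _) _ M) ler_pM2r // => h.
rewrite /psi wedge_normE /enorm mulrA ler_pdivlMr; last first.
  by rewrite mulr_gt0 ?sqrtr_gt0.
rewrite -sqrtr_sqr -!sqrtrM ?sqr_ge0 ?dotp_ge0 ?mulr_ge0 ?sqnorm6_ge0 //.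
by rewrite ler_wsqrtr.
Qed.

(** The left-hand side is the product of the sines of the two angles between A and
    B, and a sine is at most 1. *)
Lemma psi_1_ge A B x x' y y' :
  basis_of A [:: x; x'] -> basis_of B [:: y; y'] ->
  `|klein (wedge x x') (wedge y y')| /
     (Num.sqrt (sqnorm6 (wedge x x')) * Num.sqrt (sqnorm6 (wedge y y'))) <= psi_ 1 A B.
Proof.
move=> bA bB.
have fst0 z z' : free [:: z; z'] -> z != 0.
  move=> /free2P[i [j]]; apply: contra => /eqP ->.
  by rewrite /wedge !mxE; apply/eqP; ring.
have pos z z' : free [:: z; z'] -> 0 < sqnorm6 (wedge z z').
  move=> /free2P[i [j]] zz'; rewrite lt_neqAle sqnorm6_ge0 andbT eq_sym.
  apply: contra zz' => /eqP; rewrite /sqnorm6 /sum6 => h.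
  have: forall i j : 'I_4, wedge z z' i j = 0.
    have w0 : forall i' j' : 'I_4, (i' < j')%N -> wedge z z' i' j' = 0.
      have s i' j' := sqr_ge0 (wedge z z' i' j').
      have h0 := (s o0 o1, s o0 o2, s o0 o3, s o1 o2, s o1 o3, s o2 o3).
      by apply: ord4P; apply: ord4P => //= _; apply/eqP; rewrite -sqrf_eq0;
        apply/eqP/le_anti; rewrite s andbT; move: h h0 => + [[[[[? ?] ?] ?] ?] ?]; lra.
    move=> i' j'; case: (ltngtP i' j') => [|lt|e]; first exact: w0.
      have -> : wedge z z' i' j' = - wedge z z' j' i' by rewrite /wedge; ring.
      by rewrite w0 ?oppr0.
    by rewrite /wedge (val_inj e) subrr.
  by move=> ->.
have fA := basis_free bA; have fB := basis_free bB.
apply: lb_le_inf.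
  exists (psi x y), (x, y) => //=; split => //=; rewrite ?(fst0 _ _ fA) ?(fst0 _ _ fB) //.
    by apply: (basis_mem bA); rewrite inE eqxx.
  by apply: (basis_mem bB); rewrite inE eqxx.
move=> _ [[X Y] [/= XA X0 YB Y0 _] <-].
rewrite ler_pdivrMr; last by rewrite mulr_gt0 ?sqrtr_gt0 ?pos.
by rewrite [leRHS]mulrC; exact: (psi_ge_klein bA bB).
Qed.

(** The area |a /\ b| is also |(a - b) /\ a|, at most |a - b| |a|. *)
Lemma psi_1_le A B a b : a \in A -> a != 0 -> b \in B -> b != 0 ->
  psi_ 1 A B <= enorm (a - b) / enorm b.
Proof.
move=> aA a0 bB b0; apply: (@le_trans _ _ (psi a b)).
  apply: ge_inf; last by exists (a, b).
  by exists 0 => _ [p _ <-]; exact: psi_ge0.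
have a0' := dotp_gt0 a0; have b0' := dotp_gt0 b0.
rewrite /psi /enorm invfM mulrA ler_pM2r ?invr_gt0 ?sqrtr_gt0 //.
rewrite ler_pdivrMr ?sqrtr_gt0 // -sqrtrM ?dotp_ge0 // wedge_normE ler_wsqrtr //.
have -> : sqnorm6 (wedge a b) = sqnorm6 (wedge (a - b) a).
  by rewrite /sqnorm6 /sum6 /wedge !mxE; ring.
by rewrite lagrange lerBlDr lerDl sqr_ge0.
Qed.

End FirstAngle.

(** * Dirichlet's theorem for a linear form in three variables *)

Section Dirichlet.
Variable R : realType.

Definition lform (n1 n2 n3 : R) (y1 y2 y3 : int) : R :=
  n1 * y1%:~R + n2 * y2%:~R + n3 * y3%:~R.

(** The (M + 1)^3 points of {0..M}^3 are sent by the form into an interval of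
    length 2 S M, where S is the sum of the absolute values of the coefficients.
    Once the interval is rescaled to length M^3, integer parts take at most
    M^3 + 1 values, so two points have the same one. *)
Lemma dirichlet3 (n1 n2 n3 : R) (M : nat) : (0 < M)%N ->
  exists y : int * int * int, [/\ y != 0,
    [/\ (`|y.1.1| <= M)%N, (`|y.1.2| <= M)%N & (`|y.2| <= M)%N] &
    `|lform n1 n2 n3 y.1.1 y.1.2 y.2| <= 2 * (`|n1| + `|n2| + `|n3|) / M%:R ^+ 2].
Proof.
move=> M0; set S := `|n1| + `|n2| + `|n3|.
have MR : 0 < M%:R :> R by rewrite ltr0n.
have S0 : 0 <= S by rewrite !addr_ge0.
have [S00|Sneq] := eqVneq S 0.
  exists (1, 0, 0); split => //=.
  move: S00; rewrite /S => /eqP; rewrite !paddr_eq0 ?addr_ge0 // !normr_eq0.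
  by move=> /andP[/andP[/eqP-> /eqP->] /eqP->]; rewrite /lform !mul0r !addr0 !normr0 !addr0 mulr0 mul0r.
have {S0 Sneq} S0 : 0 < S by rewrite lt_neqAle eq_sym Sneq.
pose T : finType := ('I_M.+1 * 'I_M.+1 * 'I_M.+1)%type.
(* The shift by S M makes all values nonnegative. *)
pose v (k : T) : R := lform n1 n2 n3 k.1.1 k.1.2 k.2 + S * M%:R.
have vb (k : T) : 0 <= v k <= 2 * S * M%:R.
  have tb (a : R) (i : 'I_M.+1) : - (`|a| * M%:R) <= a * i%:Z%:~R <= `|a| * M%:R.
    rewrite -ler_norml normrM ler_wpM2l //.
    by rewrite ger0_norm ?ler0n // ler_nat -ltnS.
  move: (tb n1 k.1.1) (tb n2 k.1.2) (tb n3 k.2).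
  rewrite /v /lform /S => /andP[? ?] /andP[? ?] /andP[? ?].
  by apply/andP; split; lra.
pose s (k : T) : R := v k * M%:R ^+ 2 / (2 * S).
have sb k : 0 <= s k <= (M ^ 3)%:R.
  have /andP[v0 v1] := vb k.
  rewrite /s divr_ge0 ?mulr_ge0 ?exprn_ge0 ?(ltW MR) ?(ltW S0) //=.
  rewrite ler_pdivrMr ?mulr_gt0 // natrX.
  rewrite (_ : _ ^+ 3 * _ = 2 * S * M%:R * M%:R ^+ 2); last by ring.
  by rewrite ler_wpM2r // exprn_ge0 // ltW.
have tb k : (Num.truncn (s k) < (M ^ 3).+1)%N.
  rewrite ltnS truncn_le_nat; have /andP[_ h] := sb k.
  by rewrite (le_lt_trans h) // ltr_nat.
pose f (k : T) : 'I_(M ^ 3).+1 := Ordinal (tb k).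
have : ~~ injectiveb f.
  apply/negP => /injectiveP/leq_card; rewrite !card_prod !card_ord.
  move: M0; clear; rewrite !expnS expn0 muln1 => M0 h.
  have : (M.+1 * M.+1 * M.+1 = M * (M * M) + 3 * (M * M) + 3 * M + 1)%N by ring.
  move=> e; move: h; rewrite e; move: M0 (M * M)%N (M * (M * M))%N; clear => M0 P Q; lia.
move=> /injectivePn [k [l neq /(congr1 val)/= e]].
have ev : lform n1 n2 n3 (k.1.1%:Z - l.1.1%:Z) (k.1.2%:Z - l.1.2%:Z) (k.2%:Z - l.2%:Z)
   = v k - v l by rewrite /v /lform !intrB; ring.
exists (k.1.1%:Z - l.1.1%:Z, k.1.2%:Z - l.1.2%:Z, k.2%:Z - l.2%:Z) => /=; split.
- apply: contra neq; move: k l {e ev} => [[a b] c] [[a' b'] c'] /=.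
  rewrite !xpair_eqE !subr_eq0 !eqz_nat => /andP[/andP[/eqP h1 /eqP h2] /eqP h3].
  by apply/andP; split; [apply/andP; split|]; apply/eqP/val_inj.
- move: (ltn_ord k.1.1) (ltn_ord k.1.2) (ltn_ord k.2).
  move: (ltn_ord l.1.1) (ltn_ord l.1.2) (ltn_ord l.2).
  move: (k.1.1 : nat) (k.1.2 : nat) (k.2 : nat).
  move: (l.1.1 : nat) (l.1.2 : nat) (l.2 : nat); clear => a b c a' b' c'.
  by split; lia.
have bnd (j : T) : (Num.truncn (s j))%:R <= s j < (Num.truncn (s j))%:R + 1.
  have /andP[s0 _] := sb j.
  by rewrite truncn_le s0 /= natr1 truncnS_gt.
have ds : `|s k - s l| <= 1.
  move: (bnd k) (bnd l); rewrite e => /andP[? ?] /andP[? ?].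
  by rewrite ler_norml; apply/andP; split; lra.
rewrite ev; have -> : v k - v l = (s k - s l) * (2 * S / M%:R ^+ 2).
  by rewrite /s; field; rewrite !gt_eqF.
have c0 : 0 <= 2 * S / M%:R ^+ 2 by rewrite divr_ge0 ?mulr_ge0 ?exprn_ge0 // ltW.
by rewrite normrM (ger0_norm c0) ler_piMl.
Qed.

Lemma gcd_reduce (y : int * int * int) : y != 0 ->
  exists z : int * int * int, exists2 g : nat, (0 < g)%N &
   y = (g%:Z * z.1.1, g%:Z * z.1.2, g%:Z * z.2) /\
   (gcdn `|z.1.1| (gcdn `|z.1.2| `|z.2|) = 1)%N.
Proof.
case: y => [[a b] c] y0.
pose g := gcdn `|a| (gcdn `|b| `|c|).
have g0 : (0 < g)%N.
  rewrite !gcdn_gt0 !absz_gt0.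
  move: y0; rewrite !xpair_eqE !negb_and -orbA.
  by case: (a != 0); case: (b != 0).
have ga : (g%:Z %| a)%Z by exact: dvdn_gcdl.
have gb : (g%:Z %| b)%Z by exact: dvdn_trans (dvdn_gcdr _ _) (dvdn_gcdl _ _).
have gc : (g%:Z %| c)%Z by exact: dvdn_trans (dvdn_gcdr _ _) (dvdn_gcdr _ _).
exists ((a %/ g)%Z, (b %/ g)%Z, (c %/ g)%Z), g => //=; split.
  by rewrite ![g%:Z * _]mulrC !divzK.
apply/eqP; rewrite -(eqn_pmul2r g0) mul1n !muln_gcdl.
by rewrite -![(absz _ * g)%N](abszM _ g%:Z) !divzK.
Qed.

(** Dividing by the gcd only improves both bounds. *)
Lemma dirichlet3_primitive (n1 n2 n3 : R) (M : nat) : (0 < M)%N ->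
  exists y : int * int * int,
    [/\ (gcdn `|y.1.1| (gcdn `|y.1.2| `|y.2|) = 1)%N,
    [/\ (`|y.1.1| <= M)%N, (`|y.1.2| <= M)%N & (`|y.2| <= M)%N] &
    `|lform n1 n2 n3 y.1.1 y.1.2 y.2| <= 2 * (`|n1| + `|n2| + `|n3|) / M%:R ^+ 2].
Proof.
move=> M0; have [y [y0 [b1 b2 b3] bl]] := dirichlet3 n1 n2 n3 M0.
have [z [g g0 [ey gz]]] := gcd_reduce y0.
exists z; split=> //.
  by move: b1 b2 b3; rewrite ey /= !abszM /=; clear -g0; move: g0; split; nia.
apply: le_trans bl; rewrite ey /=.
have -> : lform n1 n2 n3 (g%:Z * z.1.1) (g%:Z * z.1.2) (g%:Z * z.2) =
    g%:R * lform n1 n2 n3 z.1.1 z.1.2 z.2.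
  by rewrite /lform !intrM; ring.
by rewrite normrM ger0_norm ?ler0n // ler_peMl // ler1n.
Qed.

(** The constant is explicit, one plus the sum of the inverses of the values over
    the whole box. *)
Lemma lform_box_gap (n1 n2 n3 : R) (K : nat) : 
  (forall y : int * int * int, y != 0 -> lform n1 n2 n3 y.1.1 y.1.2 y.2 != 0) ->
  exists2 Q : R, 0 < Q & forall y : int * int * int, y != 0 ->
     (`|y.1.1| <= K)%N -> (`|y.1.2| <= K)%N -> (`|y.2| <= K)%N ->
     Q^-1 < `|lform n1 n2 n3 y.1.1 y.1.2 y.2|.
Proof.
move=> L0.
pose T : finType := ('I_(2 * K).+1 * 'I_(2 * K).+1 * 'I_(2 * K).+1)%type.
pose F (k : T) : R :=
  `|lform n1 n2 n3 (k.1.1%:Z - K%:Z) (k.1.2%:Z - K%:Z) (k.2%:Z - K%:Z)|^-1.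
have F0 k : 0 <= F k by rewrite invr_ge0.
have Q0 : 0 < 1 + \sum_k F k by rewrite ltr_pwDl // sumr_ge0.
exists (1 + \sum_k F k) => //.
move=> [[a b] c] /= y0 ha hb hc; have := L0 _ y0; rewrite /= -normr_gt0 => l0.
rewrite invf_plt // -[ltLHS]addr0.
pose k : T := (inord (absz (a + K%:Z)), inord (absz (b + K%:Z)), inord (absz (c + K%:Z))).
have -> : `|lform n1 n2 n3 a b c|^-1 = F k.
  rewrite /F /k /= !inordK; [|lia|lia|lia].
  by congr (`| lform _ _ _ _ _ _ |^-1); lia.
by rewrite addr0 (bigD1 k) //= addrCA ltrDl ltr_pwDl // sumr_ge0.
Qed.

End Dirichlet.

(** * Every irrational plane has exponent at least 3 *)

Section LowerBound.
Variable R : realType.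
Local Notation V := 'rV[R]_4.
Implicit Types (A B : {vspace V}) (y : int * int * int).

Definition row4 (a b c d : R) : V := \row_i nth 0 [:: a; b; c; d] i.

Definition e0 : V := row4 1 0 0 0.

Definition point y : V := row4 0 y.1.1%:~R y.1.2%:~R y.2%:~R.

Definition plane y : {vspace V} := <<[:: e0; point y]>>%VS.

Lemma plane_basis y : y != 0 -> basis_of (plane y) [:: e0; point y].
Proof.
move=> y0; rewrite /basis_of eqxx /=; apply/free2P.
case: y y0 => [[a b] c]; rewrite !xpair_eqE !negb_and -orbA.
move=> /or3P[h|h|h]; [exists o0, o1|exists o0, o2|exists o0, o3];
  by rewrite /wedge !mxE /= mul1r mulr0 subr0 intr_eq0.
Qed.

Lemma plane_rational y : y != 0 -> rational_subspaces 2 (plane y).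
Proof.
move=> /plane_basis bp; split.
  by rewrite (@size_basis _ _ _ _ (in_tuple [:: e0; point y]) bp).
exists [:: e0; point y]; split => // v; rewrite !inE => /orP[/eqP->|/eqP->].
  apply: ord4P; rewrite mxE /=; [exists 1|exists 0|exists 0|exists 0];
    by rewrite ?rmorph1 ?rmorph0.
apply: ord4P; rewrite mxE /=; [exists 0|exists y.1.1%:~R|exists y.1.2%:~R|exists y.2%:~R];
  by rewrite ?rmorph0 ?ratr_int.
Qed.

(** The Plücker coordinates of the plane are y followed by three zeros, so they
    are primitive when y is. *)
Lemma plane_height y : gcdn `|y.1.1| (gcdn `|y.1.2| `|y.2|) = 1%N ->
  height 2 (plane y) = Num.sqrt (y.1.1%:~R ^+ 2 + y.1.2%:~R ^+ 2 + y.2%:~R ^+ 2).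
Proof.
move=> gy.
have y0 : y != 0 by apply: contra_eq_neq gy => ->.
pose iy (i : 'I_4) : int := nth 0 [:: 0; y.1.1; y.1.2; y.2] i.
pose Xi : {ffun {ffun 'I_2 -> 'I_4} -> int} :=
  [ffun f : {ffun 'I_2 -> 'I_4} => if f ord0 == o0 then iy (f (lift ord0 ord0)) else 0].
have eXi (f : {ffun 'I_2 -> 'I_4}) : increasing f ->
    (Xi f)%:~R = wedge e0 (point y) (f ord0) (f (lift ord0 ord0)) :> R.
  rewrite increasing2E /Xi ffunE.
  move: (f ord0) (f (lift ord0 ord0)).
  by apply: ord4P; apply: ord4P => //= _; rewrite /wedge !mxE /iy /= ?mulr0 ?mul0r ?mul1r ?subrr ?subr0.
have prim : primitive_pluecker (plane y) Xi.
  split; last first.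
    rewrite big_increasing !ffunE /= /iy /= !gcdn0 -[RHS]gy.
    by [].
  exists (in_tuple [:: e0; point y]); split; first exact: plane_basis.
  exists 1; rewrite ?oner_eq0 // => f incf.
  by rewrite eXi // mul1r [in RHS](pair_map_eta f) plueckerE !(tnth_nth 0).
rewrite (height_wedge prim eXi); congr Num.sqrt.
by rewrite /sqnorm6 /sum6 /wedge !mxE /=; ring.
Qed.

Section Irrational.
Variables (A : {vspace V}) (u v : V).
Hypotheses (bA : basis_of A [:: u; v])
  (irr : forall B, rational_subspaces 2 B -> forall x, x \in A -> x \in B -> x = 0).

Let n1 : R := wedge u v o2 o3.
Let n2 : R := wedge u v o3 o1.
Let n3 : R := wedge u v o1 o2.
Let nn : R := n1 ^+ 2 + n2 ^+ 2 + n3 ^+ 2.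

(** If the normal vanished, the projection of A along e0 would be degenerate, so A
    would contain e0, hence meet a rational plane. *)
Lemma normal_gt0 : 0 < nn.
Proof.
rewrite lt_neqAle !addr_ge0 ?sqr_ge0 // andbT; apply/negP => /eqP/esym e.
have h1 := sqr_ge0 n1; have h2 := sqr_ge0 n2; have h3 := sqr_ge0 n3.
have n10 : n1 = 0 by apply/eqP; rewrite -sqrf_eq0; apply/eqP; move: e; rewrite /nn; lra.
have n20 : n2 = 0 by apply/eqP; rewrite -sqrf_eq0; apply/eqP; move: e; rewrite /nn; lra.
have n30 : n3 = 0 by apply/eqP; rewrite -sqrf_eq0; apply/eqP; move: e; rewrite /nn; lra.
have uA : u \in A by apply: (basis_mem bA); rewrite inE eqxx.
have vA : v \in A by apply: (basis_mem bA); rewrite !inE eqxx orbT.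
have z0 (i : 'I_4) : u 0 i *: v - v 0 i *: u = 0 \/ i = o0.
  have [->|i0] := eqVneq i o0; [by right|left].
  apply: (irr (@plane_rational (1, 0, 0) isT)); first by rewrite memvB ?memvZ.
  suff -> : u 0 i *: v - v 0 i *: u = (u 0 i * v 0 o0 - v 0 i * u 0 o0) *: e0.
    by rewrite memvZ // (basis_mem (plane_basis _)) // inE eqxx.
  apply/rowP; move: n10 n20 n30; rewrite /n1 /n2 /n3 /wedge => n10 n20 n30.
  by move: i i0; apply: ord4P => // _; apply: ord4P; rewrite !mxE /=; lra.
have /free2P[i [j]] := basis_free bA; apply/negP; rewrite negbK.
have [zi|ei] := z0 i.
  by have /rowP/(_ j) := zi; rewrite !mxE /wedge => h; apply/eqP; lra.
have [zj|->] := z0 j; last by rewrite ei /wedge subrr.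
by have /rowP/(_ i) := zj; rewrite !mxE /wedge => h; apply/eqP; lra.
Qed.

(** Decompose y in R^3 as its projection on the plane spanned by the last three
    coordinates of u and v plus a multiple of the normal.  The projection is
    al u' + be v', with al and be given by the dual basis (v' x n) / |n|^2,
    (n x u') / |n|^2.  Lift it to a in A, and correct the first coordinate of
    (0, y) by a multiple of e0 to obtain b.  The last clause excludes a = 0 when
    y is large compared with the distance. *)
Lemma near_point y : exists a b, [/\ a \in A, b \in plane y,
  dotp (a - b) (a - b) = lform n1 n2 n3 y.1.1 y.1.2 y.2 ^+ 2 / nn,
  y.1.1%:~R ^+ 2 + y.1.2%:~R ^+ 2 + y.2%:~R ^+ 2 <= dotp b b
  & a = 0 -> y.1.1%:~R ^+ 2 + y.1.2%:~R ^+ 2 + y.2%:~R ^+ 2 <= dotp (a - b) (a - b)].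
Proof.
have nn0 : nn != 0 by rewrite gt_eqF // normal_gt0.
have uA : u \in A by apply: (basis_mem bA); rewrite inE eqxx.
have vA : v \in A by apply: (basis_mem bA); rewrite !inE eqxx orbT.
case: y => [[a1 a2] a3]; set y := (a1, a2, a3).
pose y1 : R := a1%:~R; pose y2 : R := a2%:~R; pose y3 : R := a3%:~R.
pose al := (y1 * (v 0 o2 * n3 - v 0 o3 * n2) + y2 * (v 0 o3 * n1 - v 0 o1 * n3)
   + y3 * (v 0 o1 * n2 - v 0 o2 * n1)) / nn.
pose be := (y1 * (n2 * u 0 o3 - n3 * u 0 o2) + y2 * (n3 * u 0 o1 - n1 * u 0 o3)
   + y3 * (n1 * u 0 o2 - n2 * u 0 o1)) / nn.
pose L := lform n1 n2 n3 a1 a2 a3.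
pose a := al *: u + be *: v.
pose b := a 0 o0 *: e0 + point y.
have bsq : y1 ^+ 2 + y2 ^+ 2 + y3 ^+ 2 <= dotp b b.
  rewrite dotpE /b [in leRHS]mxE !mxE /= -/y1 -/y2 -/y3.
  have := sqr_ge0 (al * u 0 o0 + be * v 0 o0); rewrite !expr2; lra.
have ab : a - b = - (L / nn) *: row4 0 n1 n2 n3.
  have clear_den (p q r s t w : R) : p * r + q * s - t * nn = - L * w ->
      (p / nn) * r + (q / nn) * s - t = - (L / nn) * w.
    move=> h; apply: (mulIf nn0).
    transitivity (p * r + q * s - t * nn); first by field.
    by rewrite h; field.
  apply/rowP; apply: ord4P; rewrite /b !mxE /=; first by ring.
  - rewrite mulr0 add0r; apply: clear_den.
    by rewrite /L /lform -/y1 -/y2 -/y3 /nn /n1 /n2 /n3 /wedge; ring.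
  - rewrite mulr0 add0r; apply: clear_den.
    by rewrite /L /lform -/y1 -/y2 -/y3 /nn /n1 /n2 /n3 /wedge; ring.
  - rewrite mulr0 add0r; apply: clear_den.
    by rewrite /L /lform -/y1 -/y2 -/y3 /nn /n1 /n2 /n3 /wedge; ring.
exists a, b; split => //.
- by rewrite memvD ?memvZ.
- have [y00|yn0] := eqVneq y 0.
    rewrite /b y00; have -> : point 0 = 0.
      by apply/rowP; apply: ord4P; rewrite !mxE.
    by rewrite addr0 memvZ // memv_span // inE eqxx.
  by rewrite memvD ?memvZ // memv_span // !inE eqxx ?orbT.
- rewrite ab dotpE !mxE /=.
  transitivity ((L / nn) ^+ 2 * nn); last by rewrite -/L; field.
  by rewrite /nn; ring.
- by move=> ->; rewrite (_ : dotp (0 - b) (0 - b) = dotp b b) // !dotpE !mxE; ring.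
Qed.

(** Dirichlet's theorem provides y with |n.y| << |y|^-2.  As n.y never vanishes, a
    large parameter M leaves out all the points y of a given box, so the heights
    are arbitrarily large. *)
Lemma psi_1_small : exists2 C : R, 0 < C & forall K : nat,
  exists B, [/\ rational_subspaces 2 B, K%:R <= height 2 B &
    psi_ 1 A B <= C / height 2 B ^+ 3].
Proof.
have nn0 := normal_gt0.
set S := `|n1| + `|n2| + `|n3|.
have S0 : 0 <= S by rewrite !addr_ge0.
have sn0 : 0 < Num.sqrt nn by rewrite sqrtr_gt0.
exists (6 * S / Num.sqrt nn + 1); first by rewrite ltr_wpDl // divr_ge0 ?mulr_ge0 // ltW.
move=> K.
have ny (y : int * int * int) : y != 0 ->
    1 <= y.1.1%:~R ^+ 2 + y.1.2%:~R ^+ 2 + y.2%:~R ^+ 2 :> R.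
  move=> y0; rewrite -!rmorphXn -!rmorphD /= -[1]/(1%:~R) ler_int.
  case: y y0 => [[a b] c]; rewrite !xpair_eqE !negb_and -orbA /=; nia.
have L0 (y : int * int * int) : y != 0 -> lform n1 n2 n3 y.1.1 y.1.2 y.2 != 0.
  move=> y0; apply/negP => /eqP ly.
  have [a [b [aA bB e nb na]]] := near_point y.
  move: e; rewrite ly expr0n mul0r => e.
  have eab : a = b.
    apply/eqP; rewrite -subr_eq0; apply: contraPT e => /dotp_gt0 h e; by rewrite e ltxx in h.
  have a0 := irr (plane_rational y0) aA; rewrite eab in a0.
  have := le_trans (ny y y0) nb; rewrite a0 // dotpE !mxE; lra.
have [Q Q0 gap] := lform_box_gap K L0.
(* M^2 > T makes the form smaller than 1 / Q, hence y leaves the box, and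
   smaller than |n|, hence a is nonzero. *)
pose T := 2 * S * (Q + (Num.sqrt nn)^-1).
have T0 : 0 <= T by rewrite mulr_ge0 ?mulr_ge0 // addr_ge0 ?invr_ge0 // ltW.
pose M := (Num.truncn T).+1.
have MR : 1 <= M%:R :> R by rewrite ler1n.
have TM : T < M%:R ^+ 2.
  by apply: (lt_le_trans (truncnS_gt T)); rewrite expr2 ler_peMl.
have [y [gy [b1 b2 b3] Ly]] := dirichlet3_primitive n1 n2 n3 (isT : (0 < M)%N).
have y0 : y != 0 by apply: contra_eq_neq gy => ->.
have M2 : 0 < M%:R ^+ 2 :> R by rewrite exprn_gt0 // (lt_le_trans ltr01).
have LQ : `|lform n1 n2 n3 y.1.1 y.1.2 y.2| < Q^-1.
  apply: (le_lt_trans Ly); rewrite ltr_pdivrMr // [ltRHS]mulrC ltr_pdivlMr // -/S.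
  apply: le_lt_trans TM; rewrite /T ler_wpM2l ?mulr_ge0 //.
  by rewrite lerDl invr_ge0 ltW.
have Ln : `|lform n1 n2 n3 y.1.1 y.1.2 y.2| < Num.sqrt nn.
  apply: (le_lt_trans Ly); rewrite ltr_pdivrMr // [ltRHS]mulrC -ltr_pdivrMr // -/S.
  apply: le_lt_trans TM; rewrite /T ler_wpM2l ?mulr_ge0 //.
  by rewrite lerDr ltW.
set H := height 2 (plane y).
have eH : H = Num.sqrt (y.1.1%:~R ^+ 2 + y.1.2%:~R ^+ 2 + y.2%:~R ^+ 2) by exact: plane_height.
have HH : H ^+ 2 = y.1.1%:~R ^+ 2 + y.1.2%:~R ^+ 2 + y.2%:~R ^+ 2.
  by rewrite eH sqr_sqrtr // !addr_ge0 ?sqr_ge0.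
have H1 : 1 <= H by rewrite eH -[leLHS]sqrtr1 ler_wsqrtr // ny.
have H0 : 0 < H by exact: lt_le_trans H1.
exists (plane y); split; first exact: plane_rational.
  rewrite -/H leNgt; apply/negP => HK.
  have sm (k : int) : k%:~R ^+ 2 <= H ^+ 2 -> (`|k| <= K)%N.
    move=> kH; rewrite -(ler_nat R) natr_absz intr_norm (le_trans _ (ltW HK)) //.
    by rewrite -(ger0_norm (ltW H0)) -ler_sqr ?nnegrE // !real_normK ?num_real.
  have s1 := sqr_ge0 (y.1.1%:~R : R); have s2 := sqr_ge0 (y.1.2%:~R : R).
  have s3 := sqr_ge0 (y.2%:~R : R).
  have := gap y y0; rewrite ltNge (ltW LQ) => g; apply: notF; apply: g; apply: sm; rewrite HH; lra.
rewrite -/H; have [a [b [aA bB e nb na]]] := near_point y.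
have bb : H ^+ 2 <= dotp b b by rewrite HH.
have b0 : b != 0.
  apply: contraTneq bb => ->; rewrite -ltNge.
  by rewrite dotpE !mxE !mulr0 !addr0 exprn_gt0.
have a0 : a != 0.
  apply/eqP => /na; rewrite e leNgt => /negP; apply.
  apply: (@lt_le_trans _ _ 1); last exact: ny.
  rewrite ltr_pdivrMr // mul1r -(sqr_sqrtr (ltW nn0)) -[ltLHS]real_normK ?num_real //.
  by rewrite ltr_sqr ?nnegrE // ltW.
apply: (le_trans (psi_1_le aA a0 bB b0)).
have -> : enorm (a - b) = `|lform n1 n2 n3 y.1.1 y.1.2 y.2| / Num.sqrt nn.
  by rewrite /enorm e sqrtrM ?sqr_ge0 // sqrtr_sqr sqrtrV // ltW.
have Hb : H <= enorm b.
  by rewrite -(ger0_norm (ltW H0)) -sqrtr_sqr ler_wsqrtr.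
have HM : H ^+ 2 <= 3 * M%:R ^+ 2.
  have sm (k : int) : (`|k| <= M)%N -> k%:~R ^+ 2 <= M%:R ^+ 2 :> R.
    move=> kM; rewrite -real_normK ?num_real // -intr_norm -natr_absz.
    by rewrite ler_sqr ?nnegrE ?ler0n // ler_nat.
  have := sm _ b1; have := sm _ b2; have := sm _ b3; rewrite HH; lra.
have LH : `|lform n1 n2 n3 y.1.1 y.1.2 y.2| <= 6 * S / H ^+ 2.
  apply: (le_trans Ly); rewrite -/S ler_pdivrMr // mulrAC ler_pdivlMr ?exprn_gt0 //.
  by have := ler_wpM2l S0 HM; lra.
apply: (@le_trans _ _ (6 * S / H ^+ 2 / Num.sqrt nn / H)).
  apply: ler_pM; rewrite ?invr_ge0 ?divr_ge0 ?sqrtr_ge0 //.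
    by rewrite ler_wpM2r // invr_ge0 ltW.
  by rewrite lef_pV2 ?posrE // (lt_le_trans H0).
rewrite -subr_ge0 (_ : _ - _ = (H ^+ 3)^-1) ?invr_ge0 ?exprn_ge0 ?(ltW H0) //.
by field; rewrite !gt_eqF.
Qed.

End Irrational.
(** If only finitely many planes satisfied psi_1 <= H^-beta for some beta < 3,
    their heights would be bounded, but C H^-3 <= H^-beta for all H large enough. *)
Lemma mu_ge3 A : irrational_subspaces 2 2 1 A -> (3%:R%:E <= mu 2 1 A)%E.
Proof.
move=> [dA irrA].
have [u [v bA]] : exists u v, basis_of A [:: u; v].
  have := vbasisP A; move: (vbasis A); rewrite dA => b.
  by rewrite (tuple2E b); exists (tnth b ord0), (tnth b (lift ord0 ord0)).
have irr B : rational_subspaces 2 B -> forall x, x \in A -> x \in B -> x = 0.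
  move=> ratB x xA xB; have := irrA B ratB; rewrite ltnS leqn0 dimv_eq0 => /eqP AB.
  by apply/eqP; rewrite -memv0 -AB memv_cap xA.
have [C C0 small] := psi_1_small bA irr.
have key (beta : R) : 0 < beta -> beta < 3 -> (beta%:E <= mu 2 1 A)%E.
  move=> b0 b3; apply: ereal_sup_ubound; exists beta => //; split=> // fin.
  have [s es] := (finite_seqP _).1 fin.
  pose d := 3 - beta; have d0 : 0 < d by rewrite subr_gt0.
  pose K := (Num.truncn (\sum_(B <- s) height 2 B + C `^ d^-1)).+1.
  have [B [ratB HB psiB]] := small K.
  set H := height 2 B in HB psiB.
  have Hge0 B' : 0 <= height 2 B' :> R by rewrite /height sqrtr_ge0.
  have KH : \sum_(B <- s) height 2 B + C `^ d^-1 < H.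
    exact: lt_le_trans (truncnS_gt _) HB.
  have S0 : 0 <= \sum_(B <- s) height 2 B.
    exact: (sumr_ge0 _ (fun B1 _ => Hge0 B1)).
  have H0 : 0 < H.
    by apply: le_lt_trans KH; rewrite addr_ge0 // powR_ge0.
  have CH : C <= H `^ d.
    rewrite -[leLHS]powRr1 ?(ltW C0) // -(mulVf (lt0r_neq0 d0)) powRrM.
    apply: ge0_ler_powR; rewrite ?nnegrE ?powR_ge0 ?(ltW d0) ?(ltW H0) //.
    by apply/ltW/(le_lt_trans _ KH); rewrite lerDr.
  have : B \in s.
    have : [set` s] B.
      rewrite -es; split => //; apply: (le_trans psiB).
      rewrite ler_pdivrMr ?exprn_gt0 // -powR_mulrn ?(ltW H0) // -powRD; last first.
        by rewrite (gt_eqF H0) implybT.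
      by rewrite addrC.
    by [].
  move=> Bs.
  have : H <= \sum_(B <- s) height 2 B 
    by rewrite (big_rem B Bs) /= lerDl; exact: (sumr_ge0 _ (fun B1 _ => Hge0 B1)).
  have := powR_ge0 C d^-1; lra.
apply/lee_subgt0Pr => e e0.
have [e3|e3] := ltP e 3.
  by rewrite -EFinB; apply: key; lra.
apply: (@le_trans _ _ 1%:E); first by rewrite -EFinB lee_fin; lra.
by apply: key; lra.
Qed.

End LowerBound.

(** * Sets of small outer measure *)

Section Covering.
Variable R : realType.
Implicit Types (S T : set R) (m d : R).

(** S has outer Lebesgue measure at most m. *)
Definition coverable S m := exists U : set R,
  [/\ measurable U, S `<=` U & (lebesgue_measure U <= m%:E)%E].

Lemma coverable_sub S T m d : S `<=` T -> m <= d -> coverable T m -> coverable S d.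
Proof.
move=> ST md [U [mU TU lU]]; exists U; split => //; first exact: subset_trans TU.
by rewrite (le_trans lU) // lee_fin.
Qed.

Lemma coverable_set0 m : 0 <= m -> coverable set0 m.
Proof. by move=> m0; exists set0; rewrite measure0 lee_fin; split. Qed.

Lemma coverableU S T m d : coverable S m -> coverable T d -> coverable (S `|` T) (m + d).
Proof.
move=> [U [mU SU lU]] [V [mV TV lV]]; exists (U `|` V); split.
- exact: measurableU.
- exact: setUSS.
- by apply: (le_trans (measureU2 lebesgue_measure mU mV)); rewrite EFinD leeD.
Qed.

Lemma coverable_seq (I : eqType) (s : seq I) (F : I -> set R) (m : I -> R) :
  (forall i, i \in s -> coverable (F i) (m i)) ->
  coverable [set x | exists2 i, i \in s & F i x] (\sum_(i <- s) m i).
Proof.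
elim: s => [|i s IH] h.
  rewrite big_nil; apply: (coverable_sub _ _ (coverable_set0 (lexx 0))) => //.
  by move=> x [].
rewrite big_cons; apply: (@coverable_sub _ (F i `|` [set x | exists2 i, i \in s & F i x])).
- move=> x [j]; rewrite inE => /orP[/eqP->|js] Fx; [by left|by right; exists j].
- exact: lexx.
apply: coverableU; first by apply: h; rewrite inE eqxx.
by apply: IH => j js; apply: h; rewrite inE js orbT.
Qed.

Lemma coverable_fin (I : finType) (F : I -> set R) (m : I -> R) :
  (forall i, coverable (F i) (m i)) ->
  coverable [set x | exists i, F i x] (\sum_i m i).
Proof.
move=> h; have := @coverable_seq _ (index_enum I) F m (fun i _ => h i).
by apply: coverable_sub => // x [i Fi]; exists i => //; exact: mem_index_enum.
Qed.

Lemma coverable_nat (F : nat -> set R) (m : nat -> R) M :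
  (forall n, 0 <= m n) -> (forall N, \sum_(n < N) m n <= M) ->
  (forall n, coverable (F n) (m n)) -> coverable [set x | exists n, F n x] M.
Proof.
move=> m0 mM /choice[U hU]; exists (\bigcup_n U n); split.
- by apply: bigcup_measurable => n _; have [] := hU n.
- by move=> x [n Fx]; exists n => //; have [_ sU _] := hU n; exact: sU.
- apply: (le_trans (generalized_Boole_inequality lebesgue_measure _ _)).
  + by move=> n; have [] := hU n.
  + by apply: bigcup_measurable => n _; have [] := hU n.
  apply: lime_le; first by apply: is_cvg_ereal_nneg_natsum => n _; exact: measure_ge0.
  apply: nearW => N.
  apply: (@le_trans _ _ (\sum_(0 <= n < N) (m n)%:E)%E).
    by apply: lee_sum => n _; have [] := hU n.
  by rewrite sumEFin lee_fin big_mkord.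
Qed.

Lemma coverable_diam S d : 0 <= d -> (forall s t, S s -> S t -> s - t <= d) ->
  coverable S (2 * d).
Proof.
move=> d0 h; have [->|/set0P[x Sx]] := eqVneq S set0.
  by apply: coverable_set0; rewrite mulr_ge0.
exists `[x - d, x + d]%classic; split => //.
  move=> y Sy /=; rewrite in_itv /=; have := h _ _ Sx Sy; have := h _ _ Sy Sx.
  by move=> ? ?; apply/andP; split; lra.
rewrite lebesgue_measure_itv /= lte_fin; case: ifP => _; last by rewrite lee_fin mulr_ge0.
by rewrite -EFinB lee_fin; lra.
Qed.

Lemma coverable_unit S m : coverable S m -> m < 1 -> exists2 s, 0 <= s <= 1 & ~ S s.
Proof.
move=> [U [mU SU lU]] m1; apply: contrapT => nex.
have sub : `[0, 1]%classic `<=` U.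
  move=> s /= ; rewrite in_itv /= => s01; apply: SU; apply: contrapT => nS.
  by apply: nex; exists s.
have := le_measure lebesgue_measure _ _ sub; rewrite !inE => /(_ _ mU) le1.
have : (lebesgue_measure (`[0%R, 1%R]%classic : set R) <= m%:E)%E.
  by apply: le_trans lU; exact: le1.
by rewrite lebesgue_measure_itv /= lte_fin ltr01 -EFinB subr0 lee_fin leNgt m1.
Qed.

End Covering.

(** * A summable sequence of weights *)

Section Weights.
Variable R : realType.
Variable e : R.
Hypothesis e0 : 0 < e.

(** The values of delta in the measure argument are products of such weights. *)
Definition weight (n : nat) : R := (n.+1%:R `^ (1 + e))^-1.

Lemma weight_gt0 n : 0 < weight n.
Proof. by rewrite invr_gt0 powR_gt0. Qed.

Lemma weight_le n : weight n <= n.+1%:R^-1.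
Proof.
rewrite lef_pV2 ?posrE ?powR_gt0 // -[leLHS]powRr1 ?ler0n // ler_powR ?ler1n //.
by rewrite lerDl ltW.
Qed.

(** Comparison of n^(-1-e) with a difference of consecutive values of n^(-e),
    from ln (1 - 1/(n+2)) <= - 1/(n+2) and exp t >= 1 + t. *)
Lemma weight_telescope n :
  e * weight n.+1 <= n.+1%:R `^ (- e) - n.+2%:R `^ (- e).
Proof.
have n0 : 0 < n.+1%:R :> R by []. have m0 : 0 < n.+2%:R :> R by [].
have nm : n.+2%:R = n.+1%:R + 1 :> R by rewrite -natr1.
have p0 : 0 < n.+2%:R `^ e :> R by rewrite powR_gt0.
rewrite /weight powRD; last by rewrite (gt_eqF m0) implybT.
rewrite powRr1 ?(ltW m0) // !powRN.
have key : 1 + e / n.+2%:R <= n.+2%:R `^ e / n.+1%:R `^ e.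
  have -> : n.+2%:R `^ e / n.+1%:R `^ e = expR (e * (ln n.+2%:R - ln n.+1%:R)) :> R.
    by rewrite /powR !gt_eqF // -expRN -expRD; congr expR; ring.
  apply: le_trans (expR_ge1Dx _); rewrite lerD2l ler_wpM2l ?(ltW e0) //.
  have : ln (1 + (- n.+2%:R^-1)) <= - n.+2%:R^-1 :> R.
    by apply: le_ln1Dx; rewrite ltrN2 invf_lt1 // ltr1n.
  have -> : 1 + - n.+2%:R^-1 = n.+1%:R / n.+2%:R :> R.
    by apply: (mulIf (lt0r_neq0 m0)); rewrite divfK ?(gt_eqF m0) // mulrDl mulNr mulVf ?(gt_eqF m0) // nm; ring.
  by rewrite ln_div ?posrE // lerNr opprB.
rewrite -(ler_pM2l p0).
have -> : n.+2%:R `^ e * (e * (n.+2%:R * n.+2%:R `^ e)^-1) = e / n.+2%:R.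
  by field; rewrite !gt_eqF.
by rewrite mulrBr mulfV ?(gt_eqF p0) // lerBrDl.
Qed.

Lemma weight_sum N : \sum_(n < N) weight n <= 1 + e^-1.
Proof.
case: N => [|N]; first by rewrite big_ord0 addr_ge0 // invr_ge0 ltW.
rewrite big_ord_recl /=; apply: lerD.
  by rewrite /weight powR1 invr1.
have : \sum_(i < N) e * weight i.+1 <= 1 - N.+1%:R `^ (- e).
  elim: N => [|N IH]; first by rewrite big_ord0 powR1 subrr.
  by rewrite big_ord_recr /=; have := weight_telescope N; lra.
rewrite -mulr_sumr => h; rewrite -[leRHS]mulr1 -ler_pdivrMl ?invr_gt0 // invrK.
by apply: le_trans h _; rewrite gerBl powR_ge0.
Qed.

End Weights.

(** * Linear forms on the circle of radius sqrt 3 *)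

(** Infinite descent modulo 3: squares are 0 or 1 modulo 3. *)
Lemma circle_no_rational_point (a b c : nat) :
  (3 * (a * a + b * b) = c * c)%N -> [/\ a = 0, b = 0 & c = 0]%N.
Proof.
elim/ltn_ind: c a b => c IH a b h.
have [c0|c0] := posnP c; first by move: h; rewrite c0; split; nia.
have sq3 n : (n * n %% 3 = (n %% 3) * (n %% 3) %% 3)%N by rewrite modnMm.
have lt3 n : (n %% 3 = 0 \/ n %% 3 = 1 \/ n %% 3 = 2)%N.
  by have := ltn_pmod n (isT : 0 < 3)%N; lia.
have [c' ec] : exists c', c = (3 * c')%N.
  exists (c %/ 3)%N; have : (c * c %% 3 = 0)%N by rewrite -h modnMr.
  by rewrite sq3; have := divn_eq c 3; case: (lt3 c) => [|[]] ->; lia.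
have h' : (a * a + b * b = 3 * (c' * c'))%N by move: h; rewrite ec; lia.
have : ((a * a + b * b) %% 3 = 0)%N by rewrite h' modnMr.
rewrite -modnDm (sq3 a) (sq3 b) => hab.
have [a3 b3] : (a %% 3 = 0 /\ b %% 3 = 0)%N.
  by move: hab; case: (lt3 a) => [|[]] ->; case: (lt3 b) => [|[]] ->.
have ea : a = (3 * (a %/ 3))%N by rewrite {1}(divn_eq a 3) a3 addn0 mulnC.
have eb : b = (3 * (b %/ 3))%N by rewrite {1}(divn_eq b 3) b3 addn0 mulnC.
move: (a %/ 3)%N (b %/ 3)%N ea eb => a' b' ea eb {hab lt3 sq3 a3 b3}.
have [||a0 b0 c0'] := IH c' _ a' b'; [lia|by move: h'; rewrite ea eb; lia|].
by rewrite ea eb ec a0 b0 c0'.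
Qed.

Section Circle.
Variable R : realType.
Implicit Types (s t d : R) (a b c : int).

Local Notation r3 := (Num.sqrt 3%:R : R).

(** The rational parametrization of the circle x^2 + y^2 = 3 from (- sqrt 3, 0).
    It turns [cform] into a quadratic polynomial of the parameter, up to the
    factor 1 + s^2. *)
Definition circle_x s : R := r3 * (1 - s ^+ 2) / (1 + s ^+ 2).
Definition circle_y s : R := r3 * (2 * s) / (1 + s ^+ 2).

Lemma r3_sqr : r3 ^+ 2 = 3.
Proof. by rewrite sqr_sqrtr ?ler0n. Qed.

Lemma circleE s : circle_x s ^+ 2 + circle_y s ^+ 2 = 3.
Proof.
have q0 : 1 + s ^+ 2 != 0 by rewrite gt_eqF // ltr_pwDl // sqr_ge0.
by rewrite /circle_x /circle_y -[RHS]r3_sqr; field.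
Qed.

Definition cform s a b c : R := a%:~R * circle_x s + b%:~R * circle_y s - c%:~R.

Let qa a c : R := - (r3 * a%:~R + c%:~R).
Let qb b : R := r3 * b%:~R.
Let disc a b c : R := 3 * (a%:~R ^+ 2 + b%:~R ^+ 2) - c%:~R ^+ 2.

(** The usual (A s + B)^2 = A (A s^2 + 2 B s + C) + (B^2 - A C) for the quadratic
    polynomial (1 + s^2) cform; its discriminant is the integer [disc]. *)
Lemma cform_disc s a b c :
  (qa a c * s + qb b) ^+ 2 = qa a c * ((1 + s ^+ 2) * cform s a b c) + disc a b c.
Proof.
have q0 : 1 + s ^+ 2 != 0 by rewrite gt_eqF // ltr_pwDl // sqr_ge0.
rewrite /cform /disc -r3_sqr /qa /qb /circle_x /circle_y; field.
exact: q0.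
Qed.

Lemma cform_quadratic s a b c : (1 + s ^+ 2) * cform s a b c =
  qa a c * s ^+ 2 + 2 * qb b * s + (r3 * a%:~R - c%:~R).
Proof.
have q0 : 1 + s ^+ 2 != 0 by rewrite gt_eqF // ltr_pwDl // sqr_ge0.
by rewrite /cform /qa /qb /circle_x /circle_y; field.
Qed.

Lemma cform_small s a b c d : 0 <= s <= 1 -> `|cform s a b c| < d ->
  `|(1 + s ^+ 2) * cform s a b c| < 2 * d.
Proof.
move=> /andP[s0 s1] h.
have s2 : 0 <= s ^+ 2 <= 1 by rewrite sqr_ge0 expr_le1.
rewrite normrM (ger0_norm (_ : 0 <= 1 + s ^+ 2)); last by case/andP: s2 => ? ?; lra.
apply: (@le_lt_trans _ _ (2 * `|cform s a b c|)); last by rewrite ltr_pM2l.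
by rewrite ler_wpM2r //; case/andP: s2 => ? ?; lra.
Qed.

Lemma cform_shift s a b c d : 0 <= s <= 1 -> `|cform s a b c| < d ->
  `|qa a c| * d <= 4^-1 ->
  `|(qa a c * s + qb b) ^+ 2 - disc a b c| <= 2^-1.
Proof.
move=> s01 h ad; rewrite cform_disc addrK normrM.
apply: (@le_trans _ _ (`|qa a c| * (2 * d))).
  by rewrite ler_wpM2l // ltW // cform_small.
by lra.
Qed.

(** Let F be the quadratic polynomial.  When F is small, (A s + B)^2 is close to
    the discriminant.  Since F(s) - F(t) = (s - t) ((A s + B) + (A t + B)), two
    such points on the same side of the vertex are close to each other. *)
Lemma cform_diam s t a b c d : 0 <= s <= 1 -> 0 <= t <= 1 ->
  `|cform s a b c| < d -> `|cform t a b c| < d -> `|qa a c| * d <= 4^-1 ->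
  1 <= disc a b c -> 0 <= (qa a c * s + qb b) * (qa a c * t + qb b) ->
  s - t <= 4 * d / Num.sqrt (disc a b c).
Proof.
move=> s01 t01 hs ht ad D1 sgn.
set D := disc a b c in D1 *.
have D0 : 0 < D by lra.
set u := qa a c * s + qb b in sgn *; set v := qa a c * t + qb b in sgn *.
have u2 : D / 2 <= u ^+ 2.
  by have := cform_shift s01 hs ad; rewrite ler_norml -/u -/D => /andP[? _]; lra.
have v2 : D / 2 <= v ^+ 2.
  by have := cform_shift t01 ht ad; rewrite ler_norml -/v -/D => /andP[? _]; lra.
have uv : Num.sqrt D <= `|u + v|.
  rewrite -sqrtr_sqr ler_wsqrtr //.
  have : (u + v) ^+ 2 = u ^+ 2 + v ^+ 2 + 2 * (u * v) by ring.
  by move=> ->; lra.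
rewrite ler_pdivlMr ?sqrtr_gt0 //.
have [st|st] := lerP s t.
  have d0 : 0 <= d by apply: ltW (le_lt_trans _ hs).
  apply: (@le_trans _ _ 0); last by rewrite mulr_ge0.
  by rewrite mulr_le0_ge0 ?sqrtr_ge0 // subr_le0.
have e : (s - t) * (u + v) =
    (1 + s ^+ 2) * cform s a b c - (1 + t ^+ 2) * cform t a b c.
  by rewrite !cform_quadratic /u /v; ring.
have : `|(s - t) * (u + v)| <= 4 * d.
  rewrite e; apply: (le_trans (ler_normB _ _)).
  by have := cform_small s01 hs; have := cform_small t01 ht; lra.
rewrite normrM ger0_norm ?subr_ge0 ?(ltW st) //.
by apply: le_trans; rewrite ler_wpM2l // subr_ge0 ltW.
Qed.

(** Two sets, one on each side of the vertex of the parabola. *)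
Lemma bad_cover a b c d : 0 <= d -> `|qa a c| * d <= 4^-1 -> 1 <= disc a b c ->
  coverable [set s | 0 <= s <= 1 /\ `|cform s a b c| < d] (16 * d / Num.sqrt (disc a b c)).
Proof.
move=> d0 ad D1.
pose P := [set s | [/\ 0 <= s <= 1, `|cform s a b c| < d & 0 <= qa a c * s + qb b]].
pose N := [set s | [/\ 0 <= s <= 1, `|cform s a b c| < d & qa a c * s + qb b <= 0]].
have m0 : 0 <= 4 * d / Num.sqrt (disc a b c) by rewrite divr_ge0 ?mulr_ge0 ?sqrtr_ge0.
have cP : coverable P (2 * (4 * d / Num.sqrt (disc a b c))).
  apply: coverable_diam => // s t [s01 hs us] [t01 ht ut].
  by apply: (@cform_diam s t a b c d) => //; exact: mulr_ge0.
have cN : coverable N (2 * (4 * d / Num.sqrt (disc a b c))).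
  apply: coverable_diam => // s t [s01 hs us] [t01 ht ut].
  by apply: (@cform_diam s t a b c d) => //; exact: mulr_le0.
apply: coverable_sub (coverableU cP cN); last by lra.
by move=> s [s01 hs]; case: (lerP 0 (qa a c * s + qb b)) => h; [left|right]; split => //; exact: ltW.
Qed.

Lemma bad_empty a b c d s : `|qa a c| * d <= 4^-1 -> disc a b c <= -1 ->
  0 <= s <= 1 -> `|cform s a b c| < d -> False.
Proof.
move=> ad D1 s01 hs; have := cform_shift s01 hs ad.
by rewrite ler_norml => /andP[_]; have := sqr_ge0 (qa a c * s + qb b); lra.
Qed.

(** Comparison with the sum of 1 / sqrt (i k), at most 2. *)
Lemma sum_inv_sqrt (k : nat) :
  \sum_(i < k.+1) (Num.sqrt (1 + (i * k)%N%:R))^-1 <= 3 :> R.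
Proof.
have [->|k0] := posnP k.
  by rewrite big_ord_recl big_ord0 addr0 muln0 addr0 sqrtr1 invr1; lra.
have kR : 0 < k%:R :> R by rewrite ltr0n.
have sk : 0 < Num.sqrt k%:R :> R by rewrite sqrtr_gt0.
suff h N : \sum_(i < N.+1) (Num.sqrt (1 + (i * k)%N%:R))^-1
    <= 1 + 2 * Num.sqrt N%:R / Num.sqrt k%:R :> R.
  by apply: le_trans (h k) _; rewrite mulfK ?gt_eqF //; lra.
elim: N => [|N IH].
  by rewrite big_ord_recl big_ord0 /= mul0n !addr0 sqrtr1 invr1 sqrtr0 mulr0 mul0r addr0.
rewrite big_ord_recr /=; apply: le_trans (lerD IH (lexx _)) _.
set x := Num.sqrt N.+1%:R; set y := Num.sqrt N%:R; set z := Num.sqrt k%:R.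
have x0 : 0 < x by rewrite sqrtr_gt0.
have y0 : 0 <= y by rewrite sqrtr_ge0.
have yx : y <= x by rewrite ler_wsqrtr // ler_nat.
have xy : x ^+ 2 = y ^+ 2 + 1 by rewrite !sqr_sqrtr ?ler0n // natr1.
have step : (Num.sqrt (1 + (N.+1 * k)%N%:R))^-1 <= x^-1 / z :> R.
  have p0 : 0 < 1 + (N.+1 * k)%N%:R :> R by rewrite ltr_pwDl.
  rewrite -invfM lef_pV2 ?posrE ?mulr_gt0 ?sqrtr_gt0 //.
  by rewrite /x /z -sqrtrM ?ler0n // ler_wsqrtr // -natrM lerDr.
have inv : x^-1 <= 2 * (x - y).
  rewrite -[leLHS]mul1r ler_pdivrMr //.
  have : 0 <= (x - y) ^+ 2 by exact: sqr_ge0.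
  rewrite !expr2 in xy *; lra.
apply: le_trans (lerD (lexx _) step) _.
have zi : 0 <= z^-1 by rewrite invr_ge0 ltW.
by have := ler_wpM2r zi inv; move: (x^-1) (z^-1) => u w; lra.
Qed.

End Circle.

(** * A badly approximable point of the circle *)

Section BadlyApproximableCirclePoint.
Variable R : realType.
Implicit Types (s t d : R) (a b c : int) (i j : nat).

Definition signed (e : bool) (n : nat) : int := if e then n%:Z else - n%:Z.

Lemma signed_abs c : c = signed (0 <= c) `|c|%N.
Proof. by rewrite /signed; case: ifP; lia. Qed.

Definition bad i j d : set R := [set s | 0 <= s <= 1 /\ exists a b c,
  [/\ `|a|%N = i, `|b|%N = j, [|| a != 0, b != 0 | c != 0] & `|cform s a b c| < d]].

Lemma circle_coord_le2 s : `|circle_x s| <= 2 /\ `|circle_y s| <= 2.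
Proof.
have e := circleE s.
have h (u v : R) : u ^+ 2 + v ^+ 2 = 3 -> `|u| <= 2.
  move=> uv; rewrite -(ger0_norm (_ : 0 <= 2)) // -ler_sqr ?nnegrE //.
  by rewrite !real_normK ?num_real //; have := sqr_ge0 v; lra.
by split; [exact: h e|apply: h; rewrite addrC; exact: e].
Qed.

Lemma cform_bound s a b c i j d : `|a|%N = i -> `|b|%N = j -> d <= 1 ->
  `|cform s a b c| < d ->
  `|- (Num.sqrt 3%:R * a%:~R + c%:~R)| <= 4 * (i.+1%:R * j.+1%:R) :> R.
Proof.
move=> ai bj d1 h; have [hx hy] := circle_coord_le2 s.
have eA : `|a%:~R| = i%:R :> R by rewrite -intr_norm -natr_absz ai.
have eB : `|b%:~R| = j%:R :> R by rewrite -intr_norm -natr_absz bj.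
have i0 : 0 <= i%:R :> R by []. have j0 : 0 <= j%:R :> R by [].
have hc : `|c%:~R| <= 2 * i%:R + 2 * j%:R + 1 :> R.
  have -> : c%:~R = a%:~R * circle_x s + b%:~R * circle_y s - cform s a b c :> R.
    by rewrite /cform; ring.
  apply: le_trans (ler_normB _ _) _; apply: lerD; last by lra.
  apply: le_trans (ler_normD _ _) _; rewrite (normrM a%:~R) (normrM b%:~R) eA eB.
  by apply: lerD; rewrite [leLHS]mulrC ler_wpM2r.
have r32 : Num.sqrt 3%:R <= 2 :> R.
  rewrite -(ger0_norm (_ : 0 <= 2 :> R)) // -sqrtr_sqr ler_wsqrtr //; lra.
rewrite normrN; apply: le_trans (ler_normD _ _) _.
rewrite normrM eA (ger0_norm (sqrtr_ge0 _)).
have := ler_wpM2r i0 r32; rewrite -!natr1.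
by have := mulr_ge0 i0 j0; lra.
Qed.

(** For given |a| = i and |b| = j, put m = 3 (i^2 + j^2).  Only the c with c^2 < m
    matter, that is |c| = k - l with 0 <= l <= k and k^2 < m, and then
    m - c^2 >= 1 + l k.  Each of the 8 choices of signs contributes at most
    16 d / sqrt (1 + l k), and the sum over l is at most 3; 384 = 8 * 16 * 3. *)
Lemma bad_pair_cover i j d : 0 <= d -> d * (i.+1%:R * j.+1%:R) <= 16^-1 ->
  coverable (bad i j d) (384 * d).
Proof.
move=> d0 dij.
have ij1 : 1 <= i.+1%:R * j.+1%:R :> R by rewrite -natrM ler1n.
have d1 : d <= 1.
  by apply: le_trans (_ : d * (i.+1%:R * j.+1%:R) <= 1); [rewrite ler_peMr|lra].
have ad s a b c : `|a|%N = i -> `|b|%N = j -> `|cform s a b c| < d ->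
    `|- (Num.sqrt 3%:R * a%:~R + c%:~R)| * d <= 4^-1 :> R.
  move=> ai bj h; have := ler_wpM2r d0 (cform_bound ai bj d1 h); lra.
pose m := (3 * (i * i + j * j))%N.
have discE a b c : `|a|%N = i -> `|b|%N = j ->
    3 * (a%:~R ^+ 2 + b%:~R ^+ 2) - c%:~R ^+ 2 = m%:R - (`|c| ^ 2)%N%:R :> R.
  move=> ai bj.
  have sq (z : int) : z%:~R ^+ 2 = (`|z| ^ 2)%N%:R :> R.
    by rewrite natrX natr_absz intr_norm real_normK ?num_real.
  by rewrite !sq ai bj /m natrM natrD !mulnn.
(* A nonpositive discriminant is at most -1, and the form is then not small. *)
have neg s a b c : 0 <= s <= 1 -> `|a|%N = i -> `|b|%N = j ->
    [|| a != 0, b != 0 | c != 0] -> `|cform s a b c| < d -> (`|c| ^ 2 < m)%N.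
  move=> s01 ai bj nz h; rewrite ltnNge; apply/negP => mc.
  have ne : m != (`|c| ^ 2)%N.
    apply/eqP => e; have [i0 j0 c0] := @circle_no_rational_point i j `|c|%N e.
    by move: nz; rewrite -!absz_eq0 ai bj i0 j0 c0.
  apply: (bad_empty (ad s a b c ai bj h) _ s01 h).
  have : (m.+1 <= `|c| ^ 2)%N by rewrite ltn_neqAle ne.
  by rewrite -(ler_nat R) -natr1 discE //; lra.
have [m0|m0] := posnP m.
  apply: (@coverable_sub _ _ set0 0); last exact: (coverable_set0 (lexx 0)); last by lra.
  move=> s [s01 [a [b [c [ai bj nz h]]]]].
  by have := neg s a b c s01 ai bj nz h; rewrite m0 ltn0.
have [k km mk] : exists2 k, (k ^ 2 < m)%N & forall l, (l ^ 2 < m)%N -> (l <= k)%N.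
  have ex : exists l, (l ^ 2 < m)%N by exists 0%N.
  have ub l : (l ^ 2 < m)%N -> (l <= m)%N by nia.
  by case: (ex_maxnP ex ub) => k km mk; exists k.
pose I : finType := (bool * bool * bool)%type.
pose F (l : 'I_k.+1) (e : I) : set R := [set s | 0 <= s <= 1 /\
  `|cform s (signed e.1.1 i) (signed e.1.2 j) (signed e.2 (k - l)%N)| < d].
pose w (l : 'I_k.+1) : R := 16 * d / Num.sqrt (1 + (l * k)%N%:R).
have w0 l : 0 <= w l by rewrite divr_ge0 ?mulr_ge0 ?sqrtr_ge0.
have absS e n : `|signed e n|%N = n by rewrite /signed; case: e; rewrite ?abszN.
have cF l e : coverable (F l e) (w l).
  set a := signed e.1.1 i; set b := signed e.1.2 j; set c := signed e.2 (k - l)%N.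
  have [[s [s01 hs]]|emp] := pselect (exists s, F l e s); last first.
    apply: coverable_sub (coverable_set0 (w0 l)) => // s Fs.
    by apply: emp; exists s.
  have D1 : 1 + (l * k)%N%:R <=
      3 * (a%:~R ^+ 2 + b%:~R ^+ 2) - c%:~R ^+ 2 :> R.
    rewrite discE ?absS // lerBrDr -[X in X + _ + _]/(1%:R) -!natrD ler_nat.
    have := ltn_ord l; move: km; move: (l : nat) => l'; clear; nia.
  have D1' : 1 <= 3 * (a%:~R ^+ 2 + b%:~R ^+ 2) - c%:~R ^+ 2 :> R.
    by apply: le_trans D1; rewrite lerDl.
  apply: coverable_sub (bad_cover d0 (ad s a b c (absS _ _) (absS _ _) hs) D1') => //.
  have p0 : 0 < 1 + (l * k)%N%:R :> R by rewrite ltr_pwDl.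
  have D0 := lt_le_trans p0 D1.
  by rewrite /w ler_wpM2l ?mulr_ge0 // lef_pV2 ?posrE ?sqrtr_gt0 // ler_wsqrtr.
have cov : coverable [set s | exists l, (exists e, F l e s)] (\sum_l \sum_(e : I) w l).
  by apply: coverable_fin => l; apply: coverable_fin => e; exact: cF.
apply: coverable_sub cov.
  move=> s [s01 [a [b [c [ai bj nz h]]]]].
  have ck := mk _ (neg s a b c s01 ai bj nz h).
  have lk : (k - `|c| < k.+1)%N by rewrite ltnS leq_subr.
  exists (Ordinal lk), (0 <= a, 0 <= b, 0 <= c); split => //=.
  by rewrite subKn // -{1}ai -{1}bj -!signed_abs.
have -> : \sum_l \sum_(e : I) w l = 8 * \sum_l w l.
  by rewrite mulr_sumr; apply: eq_bigr => l _; rewrite sumr_const !card_prod card_bool mulr_natl.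
by rewrite /w -mulr_sumr; have := ler_wpM2l d0 (sum_inv_sqrt R k); lra.
Qed.

(** The exceptional sets for all pairs (|a|, |b|) have total measure at most
    384 k W^2, where W bounds the sum of the weights; this is 1/2 for the chosen
    k, so that some parameter in [0, 1] remains. *)
Lemma circle_point (e : R) : 0 < e -> exists x y k : R,
  [/\ 0 < k, x ^+ 2 + y ^+ 2 = 3 & forall a b c, [|| a != 0, b != 0 | c != 0] ->
    k * (weight e `|a| * weight e `|b|) <= `|a%:~R * x + b%:~R * y - c%:~R|].
Proof.
move=> e0.
pose W : R := 1 + e^-1; have W1 : 1 <= W by rewrite lerDl invr_ge0 ltW.
have W0 : 0 < W by lra.
pose k : R := (768 * W ^+ 2)^-1.
have k0 : 0 < k by rewrite invr_gt0; have := exprn_gt0 2 W0; lra.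
have k16 : k <= 16^-1.
  have : 1 <= W ^+ 2 by rewrite expr_ge1 // ltW.
  by move=> W2; rewrite lef_pV2 ?posrE; lra.
have w0 n := weight_gt0 e n.
have cov i j : coverable (bad i j (k * (weight e i * weight e j)))
    (384 * (k * (weight e i * weight e j))).
  apply: bad_pair_cover; first by rewrite !mulr_ge0 ?ltW.
  rewrite -mulrA -[leRHS]mulr1; apply: ler_pM => //; rewrite ?(ltW k0) //.
    by rewrite !mulr_ge0 ?(ltW (w0 _)).
  have h n : weight e n * n.+1%:R <= 1.
    by rewrite -ler_pdivlMr ?ltr0n // mul1r weight_le.
  rewrite mulrACA -[leRHS]mulr1; apply: ler_pM => //; by rewrite mulr_ge0 ?(ltW (w0 _)).
have cov1 i : coverable [set s | exists j, bad i j (k * (weight e i * weight e j)) s]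
    (384 * k * weight e i * W).
  have m0 : 0 <= 384 * k * weight e i.
    by apply: mulr_ge0; [lra|exact: ltW].
  apply: coverable_nat (fun j => coverable_sub (@subset_refl _ _) _ (cov i j)) => [j|N|j].
  - exact: mulr_ge0 m0 (ltW (w0 j)).
  - by rewrite -mulr_sumr ler_wpM2l // weight_sum.
  - by rewrite !mulrA.
have cov2 : coverable
    [set s | exists i j, bad i j (k * (weight e i * weight e j)) s] (384 * k * W * W).
  have m0 : 0 <= 384 * k by lra.
  apply: coverable_nat cov1 => [i|N].
    by apply: mulr_ge0 (ltW W0); exact: mulr_ge0 m0 (ltW (w0 i)).
  rewrite -mulr_suml -mulr_sumr ler_wpM2r ?(ltW W0) // ler_wpM2l //.
  exact: weight_sum.
have [|s s01 ns] := coverable_unit cov2.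
  rewrite (_ : _ * W * W = 2^-1); first by lra.
  by rewrite /k; field; rewrite gt_eqF.
exists (circle_x s), (circle_y s), k; split => //; first exact: circleE.
move=> a b c nz; rewrite leNgt; apply/negP => h; apply: ns.
by exists `|a|%N, `|b|%N; split=> //; exists a, b, c.
Qed.

End BadlyApproximableCirclePoint.

(** * A plane with exponent close to 3 *)

Section UpperBound.
Variable R : realType.
Local Notation V := 'rV[R]_4.
Implicit Types (A B : {vspace V}).

(** The plane of the rows (1, y, 0, -x) and (0, x, 1, y), which has Plücker
    coordinates (x, 1, y, y, 3, x). *)
Lemma far_plane (e : R) : 0 < e -> exists A (c : R), [/\ \dim A = 2%N, 0 < c &
  forall B, rational_subspaces 2 B -> c * height 2 B `^ (- (3 + 2 * e)) <= psi_ 1 A B].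
Proof.
move=> e0; have [x [y [k [k0 xy far]]]] := circle_point e0.
pose u : V := row4 1 y 0 (- x); pose v : V := row4 0 x 1 y.
have wuv : [/\ wedge u v o0 o1 = x, wedge u v o0 o2 = 1 & wedge u v o0 o3 = y] /\
    [/\ wedge u v o1 o2 = y, wedge u v o1 o3 = 3 & wedge u v o2 o3 = x].
  by rewrite /wedge !mxE /=; split; split; rewrite -?xy; ring.
have fuv : free [:: u; v].
  by apply/free2P; exists o0, o2; case: wuv => [[_ -> _] _]; rewrite oner_eq0.
pose A : {vspace V} := <<[:: u; v]>>%VS.
have bA : basis_of A [:: u; v] by rewrite /basis_of eqxx.
have sA : sqnorm6 (wedge u v) = 4 ^+ 2.
  case: wuv => [[e1 e2 e3] [e4 e5 e6]]; rewrite /sqnorm6 /sum6 e1 e2 e3 e4 e5 e6.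
  by rewrite !expr2 in xy *; lra.
pose c : R := k * (3 `^ (1 + e))^-1 ^+ 2 / 4.
have p3 : 0 < 3 `^ (1 + e) :> R by rewrite powR_gt0.
exists A, c; split.
- by rewrite (@size_basis _ _ _ _ (in_tuple [:: u; v]) bA).
- by rewrite divr_gt0 // mulr_gt0 // exprn_gt0 // invr_gt0.
move=> B /primitive_pluecker_exists[Xi prim].
have [b1 [b2 [bB hB]]] := primitive_pluecker_wedge prim.
have H1 := height_ge1 prim; have eH := height_wedge prim hB.
set H := height 2 B in H1 eH *; have H0 : 0 < H by exact: lt_le_trans H1.
pose X (i j : 'I_4) : int := Xi (pair_map i j).
have wX (i j : 'I_4) : (i < j)%N -> wedge b1 b2 i j = (X i j)%:~R.
  by move=> ij; rewrite hB ?ffunE // increasing2E !ffunE.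
have XH (i j : 'I_4) : (i < j)%N -> `|(X i j)%:~R| <= H :> R.
  by move=> ij; apply: pluecker_le_height; rewrite // increasing2E !ffunE.
(* Collecting x, y and rational terms in the pairing with the integer point. *)
pose a := X o0 o1 + X o2 o3; pose b := X o1 o2 + X o0 o3.
pose z := X o1 o3 + 3 * X o0 o2.
have kl : klein (wedge u v) (wedge b1 b2) = a%:~R * x + b%:~R * y - z%:~R.
  case: wuv => [[e1 e2 e3] [e4 e5 e6]]; rewrite /klein e1 e2 e3 e4 e5 e6 !wX //.
  by rewrite /a /b /z !intrD intrM; ring.
have nz : [|| a != 0, b != 0 | z != 0].
  apply/negP => /negP; rewrite !negb_or !negbK => /and3P[/eqP a0 /eqP b0 /eqP z0].
  have kb : X o0 o1 * X o2 o3 - X o0 o2 * X o1 o3 + X o0 o3 * X o1 o2 = 0.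
    apply: (@intr_inj R); have := klein_wedge b1 b2; rewrite /klein !wX //.
    by rewrite !intrD intrN !intrM; lra.
  (* If a = b = c = 0, the Klein relation is X01^2 + X03^2 = 3 X02^2. *)
  have q : (3 * (`|X o0 o1| * `|X o0 o1| + `|X o0 o3| * `|X o0 o3|)
      = (3 * `|X o0 o2|) * (3 * `|X o0 o2|))%N.
    move: kb a0 b0 z0; rewrite /a /b /z.
    move: (X o0 o1) (X o0 o2) (X o0 o3) (X o1 o2) (X o1 o3) (X o2 o3); clear.
    move=> p q r s t w h1 h2 h3 h4.
    have ew : w = - p by lia. have es : s = - r by lia. have et : t = - (3 * q) by lia.
    by move: h1; rewrite ew es et; clear; nia.
  have [x0 x3 x2] := circle_no_rational_point q.
  have := H1; rewrite eH /sqnorm6 /sum6 !wX //.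
  have X01 : X o0 o1 = 0 by apply/eqP; rewrite -absz_eq0 x0.
  have X03 : X o0 o3 = 0 by apply/eqP; rewrite -absz_eq0 x3.
  have X02 : X o0 o2 = 0 by move/eqP: x2; rewrite muln_eq0 absz_eq0 => /eqP.
  move: a0 b0 z0; rewrite /a /b /z X01 X02 X03 add0r mulr0 !addr0 => -> -> ->.
  by rewrite expr0n !addr0 sqrtr0; lra.
have s4 : Num.sqrt (4 ^+ 2) = 4 :> R by rewrite sqrtr_sqr ger0_norm.
have := psi_1_ge bA bB; rewrite sA -eH kl s4.
apply: le_trans; rewrite ler_pdivlMr ?mulr_gt0 //.
apply: le_trans (far a b z nz).
have wH (t : int) : `|t%:~R| <= 2 * H -> (3 `^ (1 + e))^-1 * (H `^ (1 + e))^-1 <= weight e `|t|.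
  move=> tH; rewrite /weight -invfM lef_pV2 ?posrE ?mulr_gt0 ?powR_gt0 //.
  rewrite -powRM ?(ltW H0) // ge0_ler_powR ?nnegrE ?mulr_ge0 ?(ltW H0) ?addr_ge0 ?(ltW e0) //.
  by rewrite -natr1 natr_absz intr_norm; lra.
have wa := wH a; have wb := wH b.
have {wa} wa : (3 `^ (1 + e))^-1 * (H `^ (1 + e))^-1 <= weight e `|a|.
  apply: wa; rewrite /a intrD; apply: le_trans (ler_normD _ _) _.
  by have := XH o0 o1 isT; have := XH o2 o3 isT; lra.
have {wb} wb : (3 `^ (1 + e))^-1 * (H `^ (1 + e))^-1 <= weight e `|b|.
  apply: wb; rewrite /b intrD; apply: le_trans (ler_normD _ _) _.
  by have := XH o1 o2 isT; have := XH o0 o3 isT; lra.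
have pH : 0 < H `^ (1 + e) by rewrite powR_gt0.
have w0 : 0 <= (3 `^ (1 + e))^-1 * (H `^ (1 + e))^-1 by rewrite mulr_ge0 ?invr_ge0 ?(ltW pH) ?(ltW p3).
apply: le_trans (ler_wpM2l (ltW k0) (ler_pM w0 w0 wa wb)).
have -> : H `^ (- (3 + 2 * e)) = (H `^ (1 + e))^-1 * (H `^ (1 + e))^-1 * H^-1.
  have Hn : (H != 0) by rewrite gt_eqF.
  rewrite -powRN -(powR_inv1 (ltW H0)) -!powRD ?Hn ?implybT //.
  by congr (_ `^ _); ring.
rewrite /c le_eqVlt; apply/orP; left; apply/eqP.
by field; rewrite !gt_eqF.
Qed.

Lemma psi_1_pos_irrational A : \dim A = 2%N ->
  (forall B, rational_subspaces 2 B -> 0 < psi_ 1 A B) -> irrational_subspaces 2 2 1 A.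
Proof.
move=> dA pos; split => // B ratB.
rewrite ltnS leqn0 dimv_eq0 -subv0; apply/subvP => x; rewrite memv_cap memv0.
move=> /andP[xA xB]; apply: contraT => x0.
have := psi_1_le xA x0 xB x0; rewrite subrr leNgt (_ : enorm 0 = 0) ?mul0r ?pos //.
by rewrite /enorm dotpE !mxE !mulr0 !addr0 sqrtr0.
Qed.

(** If psi_1 <= H^-beta with beta > d > g, the lower bound c H^-g bounds the
    height, which leaves finitely many planes. *)
Lemma mu_le_of_far A (c g d : R) : 0 < c -> g < d ->
  (forall B, rational_subspaces 2 B -> c * height 2 B `^ (- g) <= psi_ 1 A B) ->
  (mu 2 1 A <= d%:E)%E.
Proof.
move=> c0 gd far; apply: ge_ereal_sup => _ [beta [b0 inf] <-].
rewrite lee_fin leNgt; apply/negP => db; apply: inf.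
have h0 : 0 < d - g by rewrite subr_gt0.
pose K := (c^-1) `^ (d - g)^-1.
apply: sub_finite_set (finite_bounded_height R (Num.truncn K).+1).
move=> B [ratB psiB]; split => //.
have [Xi prim] := primitive_pluecker_exists ratB.
have H1 := height_ge1 prim; set H := height 2 B in H1 psiB *.
have H0 : 0 < H by exact: lt_le_trans H1.
apply: ltW (le_lt_trans _ (truncnS_gt K)).
have : c * H `^ (- g) <= H `^ (- d).
  apply: le_trans (le_trans (far B ratB) psiB) _.
  by apply: ler_powR => //; rewrite lerN2 ltW.
have eg : H `^ (- g) = H `^ (- d) * H `^ (d - g).
  by rewrite -powRD; [congr (_ `^ _); ring|rewrite (gt_eqF H0) implybT].
have pd : 0 < H `^ (- d) by rewrite powR_gt0.
rewrite eg mulrCA -[leRHS]mulr1 ler_pM2l // => cH.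
have Hc : H `^ (d - g) <= c^-1 by rewrite -[leRHS]mulr1 ler_pdivlMl.
rewrite -[leLHS]powRr1 ?(ltW H0) // -(mulfV (lt0r_neq0 h0)) powRrM /K.
by apply: ge0_ler_powR; rewrite ?nnegrE ?powR_ge0 ?invr_ge0 ?(ltW h0) ?(ltW c0).
Qed.

Lemma mu_ring_le (e : R) : 0 < e -> (mu_ring R 4 2 2 1 <= (3 + 3 * e)%:E)%E.
Proof.
move=> e0; have [A [c [dA c0 far]]] := far_plane e0.
apply: ge_ereal_inf; exists (mu 2 1 A).
  exists A => //; apply: psi_1_pos_irrational => // B ratB.
  apply: lt_le_trans (far B ratB); rewrite mulr_gt0 // powR_gt0 //.
  have [Xi prim] := primitive_pluecker_exists ratB.
  exact: lt_le_trans ltr01 (height_ge1 prim).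
by apply: mu_le_of_far c0 _ far; lra.
Qed.

End UpperBound.

Local Close Scope ring_scope.
Local Close Scope classical_set_scope.

Theorem mainTheorem1 (R : realType) : mu_ring R 4 2 2 1 = (3%:R%:E)%E.
Proof.
apply/eqP; rewrite eq_le; apply/andP; split.
  apply/lee_addgt0Pr => e e0; rewrite -EFinD.
  have -> : (3 + e = 3 + 3 * (e / 3))%R by field.
  by apply: mu_ring_le; rewrite divr_gt0.
by apply: le_ereal_inf_tmp => _ [A irrA <-]; exact: mu_ge3.
Qed.
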